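(* The following holds. (a) Let $p\geq 5$ be any prime. For the group $$G=\Big\langle x_1,x_2,x_3 : [[x_i,x_j],x_k]=1 \text{ for } 1\leq i,j,k\leq 3,\ x_2^p=x_3^p=1,\ x_1^p=[x_1,x_2]\Big\rangle$$ of order $p^6$, we have $T(G)\simeq \mathbb{F}_p^\times$. (b) Let $p\geq 3$ be any prime. For the group $$G=\Big\langle x_1,x_2,x_3 : [[x_i,x_j],x_k]=1 \text{ for } 1\leq i,j,k\leq 3,\ x_2^p=x_3^p=1,\ x_1^p=[x_2,x_3]\Big\rangle$$ of order $p^6$, we have $T(G)\simeq \mathbb{F}_p^\times$. (c) Let $p\geq 5$ be any prime. For the group $$G=\Big\langle x_1,x_2,x_3,x_4 : [[x_i,x_j],x_k]=1 \text{ for } 1\leq i,j,k\leq 4,\ x_2^p=x_3^p=x_4^p=1,\ x_1^p=[x_1,x_2]\Big\rangle$$ of order $p^{10}$, we have $T(G)\simeq \mathbb{F}_p^\times$. (d) Let $p\geq 3$ be any prime. For the group $$G=\Big\langle x_1,x_2,x_3,x_4 : [[x_i,x_j],x_k]=1 \text{ for } 1\leq i,j,k\leq 4,\ x_2^p=x_3^p=x_4^p=1,\ x_1^p=[x_3,x_4]\Big\rangle$$ of order $p^{10}$, we have $T(G)\simeq \mathbb{F}_p^\times$. (e) Let $p\geq 5$ be any prime. For the group $$G=\Big\langle x_1,x_2,x_3,x_4 : [[x_i,x_j],x_k]=1 \text{ for } 1\leq i,j,k\leq 4,\ x_2^p=x_3^p=x_4^p=1,\ x_1^p=[x_1,x_2][x_3,x_4]\Big\rangle$$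 of order $p^{10}$, we have $T(G)\simeq \mathbb{F}_p^\times\times\mathbb{F}_p^\times$.
   Context: For a group $G$, let $S(G)$ be the group of all permutations of the set $G$ (maps composed from left to right, written as exponents), and let $\rho:G\to S(G)$, $x^{\rho(y)}=xy$, be the right regular representation. The holomorph of $G$ is $\mathrm{Hol}(G)=\mathrm{Aut}(G)\rho(G)$, equivalently the normalizer of $\rho(G)$ in $S(G)$. The multiple holomorph $\mathrm{NHol}(G)$ is the normalizer of $\mathrm{Hol}(G)$ in $S(G)$, and $T(G)=\mathrm{NHol}(G)/\mathrm{Hol}(G)$. For $x,y\in G$, $x^y=y^{-1}xy$ and $[x,y]=x^{-1}x^y=x^{-1}y^{-1}xy$. $\mathbb{F}_p^\times$ is the multiplicative group of the field with $p$ elements. *)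

(* Defs.v *)
From HB Require Import structures.
From mathcomp Require Import all_boot all_order all_algebra all_fingroup.

Set Implicit Arguments.
Unset Strict Implicit.
Unset Printing Implicit Defensive.

Local Open Scope group_scope.

Section Presentations.

(* G is the group presented by n generators subject to the relations rels:
   the relations hold of some family x of elements of G, and x is universal
   for this property among all groups, finite or not.  (The library's
   "G \isog Grp (...)" only determines the largest finite quotient of the
   presented group.) *)
Definition presented_by n (rels : forall H : groupType, ('I_n -> H) -> Prop)
    (G : groupType) : Prop :=
  exists x : 'I_n -> G, rels G x /\
    forall (H : groupType) (y : 'I_n -> H), rels H y ->
      exists f : G -> H,
        [/\ {morph f : u v / u * v}, forall i, f (x i) = y i
          & forall g : G -> H, {morph g : u v / u * v} ->
              (forall i, g (x i) = y i) -> g =1 f].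

Variables (p : nat) (H : groupType).

(* The ordinals 0, 1, 2, ... index the generators x1, x2, x3, ... *)
Definition rels_a (x : 'I_3 -> H) : Prop :=
  let x1 := x (inord 0) in let x2 := x (inord 1) in let x3 := x (inord 2) in
  [/\ forall i j k, [~ [~ x i, x j], x k] = 1,
      x2 ^+ p = 1, x3 ^+ p = 1 & x1 ^+ p = [~ x1, x2]].

Definition rels_b (x : 'I_3 -> H) : Prop :=
  let x1 := x (inord 0) in let x2 := x (inord 1) in let x3 := x (inord 2) in
  [/\ forall i j k, [~ [~ x i, x j], x k] = 1,
      x2 ^+ p = 1, x3 ^+ p = 1 & x1 ^+ p = [~ x2, x3]].

Definition rels_c (x : 'I_4 -> H) : Prop :=
  let x1 := x (inord 0) in let x2 := x (inord 1) in
  let x3 := x (inord 2) in let x4 := x (inord 3) in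
  [/\ forall i j k, [~ [~ x i, x j], x k] = 1,
      x2 ^+ p = 1, x3 ^+ p = 1, x4 ^+ p = 1 & x1 ^+ p = [~ x1, x2]].

Definition rels_d (x : 'I_4 -> H) : Prop :=
  let x1 := x (inord 0) in let x2 := x (inord 1) in
  let x3 := x (inord 2) in let x4 := x (inord 3) in
  [/\ forall i j k, [~ [~ x i, x j], x k] = 1,
      x2 ^+ p = 1, x3 ^+ p = 1, x4 ^+ p = 1 & x1 ^+ p = [~ x3, x4]].

Definition rels_e (x : 'I_4 -> H) : Prop :=
  let x1 := x (inord 0) in let x2 := x (inord 1) in
  let x3 := x (inord 2) in let x4 := x (inord 3) in
  [/\ forall i j k, [~ [~ x i, x j], x k] = 1,
      x2 ^+ p = 1, x3 ^+ p = 1, x4 ^+ p = 1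
    & x1 ^+ p = [~ x1, x2] * [~ x3, x4]].

End Presentations.

Section Holomorph.
Variable G : finGroupType.
Implicit Types (x y : G) (s : {perm G}).

(* Products of permutations in {perm G} compose from left to right:
   (s * t) x = t (s x). *)
Definition rho y : {perm G} := perm (mulIg y).

Definition Hol : {set {perm G}} := Aut [set: G] * (rho @: [set: G]).

Lemma rhoE y x : rho y x = x * y.
Proof. by rewrite permE. Qed.

Lemma rhoM : {morph rho : x y / x * y}.
Proof. by move=> x y; apply/permP => z; rewrite permM !rhoE mulgA. Qed.

Lemma rho_group_set : group_set (rho @: [set: G]).
Proof.
apply/group_setP; split.
  by apply/imsetP; exists 1; rewrite ?inE //; apply/permP => z; rewrite rhoE perm1 mulg1.
move=> _ _ /imsetP[x _ ->] /imsetP[y _ ->].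
by rewrite -rhoM imset_f ?inE.
Qed.
Definition rho_group := group rho_group_set.

Lemma Aut_setTP s : reflect {morph s : x y / x * y} (s \in Aut [set: G]).
Proof.
rewrite inE; apply: (iffP andP) => [[_ /morphicP sM] x y|sM].
  by rewrite sM ?inE.
by split; [apply/subsetP => x; rewrite inE | apply/morphicP => x y _ _].
Qed.

Lemma Hol_norm : Hol = 'N(rho @: [set: G]).
Proof.
have Jaut s y : s \in Aut [set: G] -> rho y ^ s = rho (s y).
  move/Aut_setTP => sM; apply/permP => z.
  by rewrite /conjg !permM !rhoE sM permKV.
have AN : Aut [set: G] \subset 'N(rho @: [set: G]).
  apply/subsetP => s As; rewrite inE; apply/subsetP => _ /imsetP[_ /imsetP[y _ ->] ->].
  by rewrite Jaut // imset_f ?inE.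
apply/eqP; rewrite eqEsubset mul_subG ?(normG rho_group) //=.
apply/subsetP => s Ns.
have Nr y : rho y \in 'N(rho @: [set: G]).
  by apply: (subsetP (normG rho_group)); rewrite imset_f ?inE.
set c := s 1; set a := s * (rho c)^-1.
rewrite -[s](mulgKV (rho c)) -/a.
apply: mem_mulg; last by rewrite imset_f ?inE.
have Na : a \in 'N(rho @: [set: G]) by rewrite groupM ?groupV.
have a1 : a 1 = 1.
  by apply: (@perm_inj _ (rho c)); rewrite -permM mulgKV rhoE mul1g.
move: a Na a1 => a Na a1.
apply/Aut_setTP => x y.
have : rho y ^ a \in rho @: [set: G] by rewrite memJ_norm // imset_f ?inE.
case/imsetP => z _ E.
have E' u : a (u * y) = a u * z.
  have := congr1 (fun t : {perm G} => t (a u)) E.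
  by rewrite /conjg !permM !rhoE permK.
by rewrite E'; have := E' 1; rewrite a1 !mul1g => ->.
Qed.

Lemma Hol_group_set : group_set Hol.
Proof. by rewrite Hol_norm; apply: groupP. Qed.
Canonical Hol_group := group Hol_group_set.

Definition NHol : {set {perm G}} := 'N(Hol).

Definition T : {set coset_of Hol} := NHol / Hol.

End Holomorph.

(* Main.v *)
Require Import Defs.
From HB Require Import structures.
From mathcomp Require Import all_boot all_order all_algebra all_fingroup.
From mathcomp Require Import commutator ring.

(** Each of these groups has nilpotency class 2, with V = G/Z(G) elementary
    abelian on the generators, Z(G) = Alt^2 V, and x |-> x^p inducing the map
    V -> Alt^2 V, v |-> v_1 w0, for a fixed w0.  An automorphism is determined up to
    a homomorphism V -> Z(G) by a linear map h of V that multiplies the functional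
    v |-> v_1 and the vector w0 by the same scalar.

    An element theta of NHol(G) fixing 1 satisfies
    theta (x y) = psi_(theta y) (theta x) theta y for a homomorphism
    psi : G -> Aut(G) such that psi_(s y) = s psi_y s^-1 for all s in Aut(G).
    Equivariance under enough diagonal maps and transvections forces psi to act
    trivially on V, so that psi_y x = x D(y, x) for a bilinear equivariant
    D : V * V -> Alt^2 V, which determines theta modulo Aut(G).  A second use of
    equivariance, weight by weight, gives D(u, v) = c (u wedge v); in case (e) there
    is one more degree of freedom, since then w0 spans an invariant line with an
    invariant complement.  Every nondegenerate D = (1 - L/d)/2 o wedge comes from
    the permutation (v, w) |-> (v, w)^(d^p) followed by L on the centre; since
    d^p modulo p^2, the exponent of G, depends only on d in F_p, these permutations
    form a group isomorphic to the parameter group. *)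

Set Implicit Arguments.
Unset Strict Implicit.
Unset Printing Implicit Defensive.

Import GRing.Theory.

Local Open Scope group_scope.

Local Open Scope ring_scope.

(** * Alternating matrices over the prime field *)

(** The weight 1/2 in the model law is the Baer correspondence: for odd p it makes the commutator
    equal to the wedge and keeps powers free of quadratic terms, so questions on automorphisms
    become linear algebra over F_p. Since a presentation is a universal property among all groups,
    the model has to be proved universal by collecting words in an arbitrary group satisfying the
    relations.

    The bound p >= 5 in (a), (c), (e) comes from single matrix entries. There w0 involves x_1 and
    x_2, and every admissible diagonal map used gives e_2 weight 1. Those fixing e_k then cannot
    separate e_k from e_2, so the entry in row k and column 2 of the action of psi_(e_k) escapes
    commutation with them. It is removed by doubling e_k, which needs 4 <> 1 in F_p. In (b) and (d)
    a transvection starting at e_2 clears that column.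

    Nondegeneracy of D reflects that theta is a bijection: if D = (1 - N)/2 o wedge, then theta
    takes commutators to values of N, and injectivity on the finite centre forces N to be onto. *)

Section Alternating.

Variables (p n : nat).
Hypotheses (p_pr : prime p) (p_gt2 : (2 < p)%N).

Lemma natrFp_eq0 k : (k%:R == 0 :> 'F_p) = (p %| k)%N.
Proof. by rewrite (dvdn_pcharf (pchar_Fp p_pr)). Qed.

Lemma two_neq0 : 2%:R != 0 :> 'F_p.
Proof. by rewrite natrFp_eq0 gtnNdvd. Qed.

Lemma halfD (V : lmodType 'F_p) (x : V) : 2^-1 *: x + 2^-1 *: x = x.
Proof.
rewrite -scalerDl; have -> : 2^-1 + 2^-1 = 1 :> 'F_p.
  by rewrite -mulr2n -[RHS](@mulVf _ 2%:R) ?two_neq0 ?mulr_natr.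
exact: scale1r.
Qed.

End Alternating.

(* Alt^2 of the row space: the entries above the diagonal are stored, and altmx
   recovers the alternating matrix. *)
Definition upair n := {ij : 'I_n * 'I_n | (ij.1 < ij.2)%N}.
Definition alt (p n : nat) := {ffun upair n -> ('F_p)^o}.
HB.instance Definition _ p n := GRing.Lmodule.copy (alt p n) {ffun upair n -> ('F_p)^o}.
HB.instance Definition _ p n := Finite.copy (alt p n) {ffun upair n -> ('F_p)^o}.

Section AlternatingMatrices.

Variables (p n : nat).
Implicit Types (w : alt p n) (A h : 'M['F_p]_n) (u v : 'rV['F_p]_n).

Definition altmx w : 'M['F_p]_n := \matrix_(i, j)
  (if insub (i, j) is Some q then w q
   else if insub (j, i) is Some q then - w q else 0).
Definition mxalt A : alt p n := [ffun q : upair n => A (val q).1 (val q).2].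
Definition is_alt A := (A^T = - A) /\ forall i, A i i = 0.

Lemma altmx_lt w (i j : 'I_n) (ltij : (i < j)%N) : altmx w i j = w (Sub (i, j) ltij).
Proof. by rewrite mxE insubT. Qed.

Lemma altmx_alt w : is_alt (altmx w).
Proof.
split=> [|i]; last by rewrite mxE !insubF ?ltnn.
apply/matrixP=> i j; rewrite !mxE.
case: (ltngtP i j) => [ltij|ltji|/val_inj->].
- by rewrite (insubT (fun q : 'I_n * 'I_n => (q.1 < q.2)%N) (x := (i, j)) ltij) insubF // ltnNge ltnW.
- by rewrite (insubT (fun q : 'I_n * 'I_n => (q.1 < q.2)%N) (x := (j, i)) ltji) insubF
    ?opprK // ltnNge ltnW.
by rewrite !insubF ?ltnn ?oppr0.
Qed.

Lemma altmxN w (i j : 'I_n) : altmx w i j = - altmx w j i.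
Proof. by have [/matrixP/(_ j i)] := altmx_alt w; rewrite !mxE. Qed.

Lemma altmx0ii w i : altmx w i i = 0.
Proof. by have [_ ->] := altmx_alt w. Qed.

Lemma altmxK w : mxalt (altmx w) = w.
Proof.
apply/ffunP=> -[[i j] ltij]; rewrite ffunE /= altmx_lt.
by congr (w _); apply: val_inj.
Qed.

Lemma altmx_inj : injective altmx.
Proof. exact: can_inj altmxK. Qed.

Lemma mxaltK A : is_alt A -> altmx (mxalt A) = A.
Proof.
case=> AT A0; apply/matrixP=> i j.
case: (ltngtP i j) => [ltij|ltji|/val_inj->]; last by rewrite altmx0ii A0.
  by rewrite altmx_lt ffunE.
by rewrite altmxN altmx_lt ffunE /=; move/matrixP/(_ i j): AT; rewrite !mxE => ->; rewrite opprK.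
Qed.

Lemma mxalt_is_linear : linear mxalt.
Proof. by move=> a A B; apply/ffunP=> q; rewrite !ffunE !mxE. Qed.
HB.instance Definition _ := GRing.isLinear.Build 'F_p 'M['F_p]_n (alt p n) _ mxalt mxalt_is_linear.

Lemma altmx_is_linear : linear altmx.
Proof.
move=> a A B; apply/matrixP=> i j; rewrite !mxE.
case: insub => [q|]; first by rewrite !ffunE.
by case: insub => [q|]; rewrite ?ffunE ?mulr0 ?addr0 // opprD mulrN.
Qed.
HB.instance Definition _ := GRing.isLinear.Build 'F_p (alt p n) 'M['F_p]_n _ altmx altmx_is_linear.

Definition wedge u v : alt p n := mxalt (u^T *m v - v^T *m u).

Lemma altmx_wedge u v : altmx (wedge u v) = u^T *m v - v^T *m u.
Proof.
rewrite mxaltK //; split; last first.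
  by move=> i; rewrite !mxE !big_ord1 !mxE mulrC subrr.
by rewrite linearB /= !trmx_mul !trmxK opprB.
Qed.

Lemma wedgeE u v i j : altmx (wedge u v) i j = u 0 i * v 0 j - u 0 j * v 0 i.
Proof. by rewrite altmx_wedge !mxE !big_ord1 !mxE [v 0 i * _]mulrC. Qed.

Lemma wedgeC u v : wedge u v = - wedge v u.
Proof. by rewrite /wedge -[RHS]linearN opprB. Qed.

Lemma wedgexx u : wedge u u = 0.
Proof. by rewrite /wedge subrr linear0. Qed.

Lemma wedgeDl u1 u2 v : wedge (u1 + u2) v = wedge u1 v + wedge u2 v.
Proof. by rewrite /wedge [(u1 + u2)^T]linearD mulmxDl mulmxDr opprD addrACA linearD. Qed.

Lemma wedgeZl a u v : wedge (a *: u) v = a *: wedge u v.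
Proof. by rewrite /wedge [(a *: u)^T]linearZ -scalemxAl -scalemxAr -scalerBr linearZ. Qed.

Lemma wedgeNl u v : wedge (- u) v = - wedge u v.
Proof. by rewrite -scaleN1r wedgeZl scaleN1r. Qed.

Lemma wedgeMnl u v k : wedge (u *+ k) v = wedge u v *+ k.
Proof. by rewrite -scaler_nat wedgeZl scaler_nat. Qed.

Lemma wedgeDr v u1 u2 : wedge v (u1 + u2) = wedge v u1 + wedge v u2.
Proof. by rewrite wedgeC wedgeDl opprD -!(wedgeC v). Qed.

Lemma wedgeZr a u v : wedge u (a *: v) = a *: wedge u v.
Proof. by rewrite wedgeC wedgeZl -scalerN -wedgeC. Qed.

Lemma wedge0l v : wedge 0 v = 0.
Proof. by rewrite -(scale0r 0) wedgeZl scale0r. Qed.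

Lemma wedge0r v : wedge v 0 = 0.
Proof. by rewrite wedgeC wedge0l oppr0. Qed.

(* The action of h on Alt^2 induced by u |-> u *m h. *)
Definition altact h w : alt p n := mxalt (h^T *m altmx w *m h).

(** The point is the zero diagonal. A diagonal entry is a double sum over (j, k); the terms with j =
    k vanish, and swapping j and k cancels the others in pairs. *)
Lemma altmx_act h w : altmx (altact h w) = h^T *m altmx w *m h.
Proof.
have [wT w0] := altmx_alt w; rewrite mxaltK //; split=> [|i].
  by rewrite !trmx_mul trmxK wT mulNmx mulmxN mulmxA.
have -> : (h^T *m altmx w *m h) i i =
    \sum_(j < n) \sum_(k < n) h k i * altmx w k j * h j i.
  by rewrite mxE; apply: eq_bigr => j _; rewrite mxE mulr_suml; apply: eq_bigr => k _; rewrite mxE.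
rewrite pair_big /= (bigID (fun jk : 'I_n * 'I_n => (jk.1 < jk.2)%N)) /=.
rewrite [X in _ + X](bigID (fun jk : 'I_n * 'I_n => (jk.2 < jk.1)%N)) /=.
rewrite [X in _ + (_ + X)]big1 ?addr0; last first.
  by case=> j k /= /andP[]; rewrite -!leqNgt => h1 h2; have -> : k = j; [apply/val_inj/anti_leq; rewrite h1 h2 | rewrite w0 mulr0 mul0r].
rewrite [X in _ + X](reindex_inj (h := fun jk => (jk.2, jk.1))) /=; last by move=> [? ?] [? ?] [-> ->].
rewrite [X in _ + X](eq_bigl (fun jk : 'I_n * 'I_n => (jk.1 < jk.2)%N)); last first.
  by case=> j k /=; rewrite andbC -leqNgt; case: ltnP => // /ltnW ->.
rewrite -big_split /= big1 // => -[j k] _ /=.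
by rewrite (altmxN w k j); ring.
Qed.

Lemma altact_is_linear h : linear (altact h).
Proof.
move=> a w t; apply: altmx_inj.
by rewrite [RHS]linearP /= !altmx_act linearP mulmxDr mulmxDl -scalemxAr -scalemxAl.
Qed.
HB.instance Definition _ h :=
  GRing.isLinear.Build 'F_p (alt p n) (alt p n) _ (altact h) (altact_is_linear h).

Lemma altactD h w t : altact h (w + t) = altact h w + altact h t.
Proof. exact: linearD. Qed.

Lemma altactZ h a w : altact h (a *: w) = a *: altact h w.
Proof. exact: linearZ. Qed.

Lemma altactM h k w : altact (h *m k) w = altact k (altact h w).
Proof. by apply: altmx_inj; rewrite !altmx_act trmx_mul !mulmxA. Qed.

Lemma altact1 w : altact 1%:M w = w.
Proof. by apply: altmx_inj; rewrite altmx_act trmx1 mulmx1 mul1mx. Qed.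

Lemma altact_wedge h u v : altact h (wedge u v) = wedge (u *m h) (v *m h).
Proof.
by apply: altmx_inj; rewrite altmx_act !altmx_wedge mulmxBr mulmxBl !trmx_mul !mulmxA.
Qed.

End AlternatingMatrices.

(** * The model group *)

(* The carry of a + b in base p: a 2-cocycle of F_p which makes the p-th power of
   the model group nontrivial. *)
Definition carry p (a b : 'F_p) : nat := ((a + b) %/ (Zp_trunc (pdiv p)).+2)%N.

Lemma carryC p (a b : 'F_p) : carry a b = carry b a.
Proof. by rewrite /carry addnC. Qed.

Lemma carry0 p (a : 'F_p) : carry 0 a = 0%N.
Proof. by rewrite /carry add0n divn_small. Qed.

Lemma carryr0 p (a : 'F_p) : carry a 0 = 0%N.
Proof. by rewrite carryC carry0. Qed.

(** Both sides are the quotient of the integer sum of the three representatives by the modulus. *)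
Lemma carryA p (a b c : 'F_p) :
  (carry b c + carry a (b + c)%R = carry a b + carry (a + b)%R c)%N.
Proof.
rewrite /carry /= -!divnMDl //; congr (_ %/ _)%N.
rewrite addnCA -divn_eq [RHS]addnA -divn_eq.
by rewrite addnA.
Qed.

Section Model.

Variables (p m : nat).
Local Notation V := 'rV['F_p]_m.+1.
Local Notation W := (alt p m.+1).

(** The carrier does not depend on [w0]; the parameter lets each [w0] carry its own group structure
    on the same set. *)
Definition model (w0 : W) : Type := (V * W)%type.

Variable w0 : W.
Local Notation M := (model w0).

HB.instance Definition _ := Finite.copy M (V * W)%type.

(** The alternating half wedge produces the commutators, and the symmetric carry term produces the
    p-th powers; both are 2-cocycles of V with values in W. *)
Definition model_mul (x y : M) : M :=
  (x.1 + y.1, x.2 + y.2 + 2^-1 *: wedge x.1 y.1 + w0 *+ carry (x.1 0 0) (y.1 0 0)).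
Definition model_one : M := (0, 0).
Definition model_inv (x : M) : M :=
  (- x.1, - x.2 - w0 *+ carry (x.1 0 0) (- x.1 0 0)).

Lemma model_mulA : associative model_mul.
Proof.
case=> [u w] [v t] [z r]; congr (_, _); rewrite /= ?addrA // !mxE.
have := carryA (u 0 0) (v 0 0) (z 0 0).
move/(congr1 (fun k => w0 *+ k)); rewrite !mulrnDr wedgeDl wedgeDr !scalerDr.
move: (w0 *+ _) (w0 *+ _) (w0 *+ _) (w0 *+ _) => a b c d E.
rewrite [LHS](AC (5*2*1) ((1*2*3*4)*(6*7)*(5*8))) /= E.
by rewrite [RHS](AC (5*2*1) ((1*2*5*7)*(3*6)*(4*8))).
Qed.

Lemma model_mul1 : left_id model_one model_mul.
Proof.
by case=> u w; rewrite /model_mul /= wedge0l mxE carry0 mulr0n scaler0 !add0r !addr0.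
Qed.

Lemma model_mulV : left_inverse model_one model_inv model_mul.
Proof.
case=> u w; rewrite /model_mul /= addNr mxE carryC.
rewrite wedgeNl wedgexx oppr0 scaler0 addr0.
by rewrite addrAC subrK addNr.
Qed.

HB.instance Definition _ :=
  Finite_isGroup.Build M model_mulA model_mul1 model_mulV.

Lemma modelM (x y : M) : (x * y)%g =
  (x.1 + y.1, x.2 + y.2 + 2^-1 *: wedge x.1 y.1 + w0 *+ carry (x.1 0 0) (y.1 0 0)).
Proof. by []. Qed.

Hypothesis p_pr : prime p.

Lemma carryE (a b : 'F_p) : carry a b = ((a + b) %/ p)%N.
Proof. by congr (_ %/ _)%N; apply: Fp_cast. Qed.

(** The wedge of [x.1] with its multiples vanishes, and the carries met in adding the first
    coordinate to itself [k] times add up to the quotient of the integer product by [p]. *)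
Lemma modelX (x : M) k : (x ^+ k)%g = (x.1 *+ k,
   x.2 *+ k + w0 *+ ((k * x.1 0%R 0%R) %/ p)%N).
Proof.
elim: k => [|k IH]; first by rewrite mul0n div0n !mulr0n addr0.
rewrite expgSr IH modelM /= wedgeMnl wedgexx mul0rn scaler0 addr0.
congr (_, _); rewrite ?mulrSr // (addrAC (x.2 *+ k)).
rewrite -[LHS]addrA -mulrnDr; congr (_ + _ *+ _).
have -> : (x.1 *+ k) 0 0 = (k * nat_of_ord (x.1 0%R 0%R))%N%:R :> 'F_p.
  by rewrite natrM natr_Zp mulmxnE mulr_natl.
by rewrite carryE val_Fp_nat // -divnMDl ?prime_gt0 // addnA -divn_eq addnC -mulSn.
Qed.

Hypothesis p_gt2 : (2 < p)%N.

Lemma modelR (x y : M) : [~ x, y]%g = (0, wedge x.1 y.1) :> M.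
Proof.
apply: (mulgI (y * x)%g); rewrite -commgC !modelM /= wedge0r ?mxE carryr0 scaler0 !addr0.
congr (_, _); first exact: addrC.
rewrite carryC (wedgeC y.1) scalerN (addrC y.2) [RHS]addrAC; congr (_ + _).
by rewrite -[RHS]addrA; congr (_ + _); rewrite -[X in _ = - _ + X](halfD p_pr p_gt2) addKr.
Qed.

End Model.

Local Close Scope ring_scope.

(** * The presentation of the model group *)

Lemma exchange_expg (H : groupType) (x y c : H) a b :
    x * y = y * x * c -> commute c x -> commute c y ->
  x ^+ a * y ^+ b = y ^+ b * x ^+ a * c ^+ (a * b).
Proof.
move=> xyc cx cy.
have E1 k : x * y ^+ k = y ^+ k * x * c ^+ k.
  elim: k => [|k IH]; first by rewrite !mulg1 mul1g.
  have cky : c ^+ k * y = y * c ^+ k by apply/commute_sym/commuteX/commute_sym.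
  by rewrite expgSr mulgA IH -mulgA cky mulgA -(mulgA _ x) xyc !mulgA -mulgA -expgS.
elim: a => [|a IH]; first by rewrite mul0n !mulg1 mul1g.
rewrite expgS -mulgA IH !mulgA E1 -[_ * c ^+ b * _]mulgA.
rewrite (commuteX a (commute_sym (commuteX b (commute_sym cx)))).
by rewrite !mulgA -[_ * x * _]mulgA -expgS -[LHS]mulgA -expgnDr -mulSn.
Qed.

Section Collection.

Variable H : groupType.

Lemma collect_gen n (y : 'I_n -> H) (x : H) (a : nat) (b : 'I_n -> nat) (c : 'I_n -> H) :
    (forall i, x * y i = y i * x * c i) ->
    (forall i, commute (c i) x) -> (forall i j, commute (c i) (y j)) ->
    (forall i j, commute (c i) (c j)) ->
  x ^+ a * \prod_(i < n) y i ^+ b i =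
  \prod_(i < n) y i ^+ b i * x ^+ a * \prod_(i < n) c i ^+ (a * b i).
Proof.
elim: n y b c => [|n IH] y b c xy cx cy cc; first by rewrite !big_ord0 !mulg1 mul1g.
rewrite !big_ord_recr /= mulgA (IH _ _ (c \o widen_ord (leqnSn n))) //= => {IH}.
set P := \prod_(i < n) _; set R := \prod_(i < n) _.
have cR z : (forall i, commute z (c i)) -> R * z = z * R.
  by move=> cz; apply/commute_sym/commute_prod=> i _; apply/commuteX.
rewrite -[_ * R * _]mulgA cR => [|i]; last by apply/commute_sym/commuteX.
rewrite !mulgA -[P * _ * _]mulgA (@exchange_expg _ _ _ (c ord_max)) // -!mulgA.
by do 3!congr (_ * _); rewrite cR // => i; apply/commute_sym/commuteX.
Qed.

Definition pair_prod n (c : 'I_n -> 'I_n -> H) (e : 'I_n -> 'I_n -> nat) : H :=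
  \prod_(j < n) \prod_(i < n) c j i ^+ e j i.

Lemma commute_pair_prod n (c : 'I_n -> 'I_n -> H) e z :
  (forall i j, commute z (c i j)) -> commute z (pair_prod c e).
Proof. by move=> cz; do 2!apply: commute_prod => ? _; apply: commuteX. Qed.

Lemma pair_prodM n (c : 'I_n -> 'I_n -> H) e e' :
    (forall i j k l, commute (c i j) (c k l)) ->
  pair_prod c e * pair_prod c e' = pair_prod c (fun j i => e j i + e' j i)%N.
Proof.
move=> cc; rewrite /pair_prod -prodgM_commute => [|j k _ _]; last first.
  by apply/commute_prod=> i _; apply/commute_sym/commute_prod=> l _; apply: commuteX2.
apply: eq_bigr => j _; rewrite -prodgM_commute => [|i k _ _]; last exact: commuteX2.
by apply: eq_bigr => i _; rewrite expgnDr.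
Qed.

Lemma eq_pair_prod n (c c' : 'I_n -> 'I_n -> H) e e' :
  (forall j i, c j i ^+ e j i = c' j i ^+ e' j i) -> pair_prod c e = pair_prod c' e'.
Proof. by move=> E; do 2!apply: eq_bigr => ? _. Qed.

(** A generator of the left factor has to pass exactly the generators of smaller index in the right
    factor. By induction, only the last power of the left factor is moved at each stage. *)
Lemma collect n (y : 'I_n -> H) (a b : 'I_n -> nat) (c : 'I_n -> 'I_n -> H) :
    (forall j i, y j * y i = y i * y j * c j i) ->
    (forall i j k, commute (c i j) (y k)) ->
    (forall i j k l, commute (c i j) (c k l)) ->
  \prod_(i < n) y i ^+ a i * \prod_(i < n) y i ^+ b i =
  \prod_(i < n) y i ^+ (a i + b i) *
    pair_prod c (fun j i => if (i < j)%N then a j * b i else 0)%N.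
Proof.
rewrite /pair_prod; elim: n y a b c => [|n IH] y a b c yc cy cc; first by rewrite !big_ord0 !mulg1.
rewrite !big_ord_recr /=.
set w := widen_ord (leqnSn n).
set A := \prod_(i < n) _; set B := \prod_(i < n) _; set C := \prod_(i < n) _.
set D := \prod_(j < n) _.
rewrite ltnn mulg1 (eq_bigr (fun i => c ord_max (w i) ^+ (a ord_max * b (w i)))); last first.
  by move=> i _; rewrite ltn_ord.
set R := \prod_(i < n) _.
have cD z : (forall i j, commute z (c i j)) -> D * z = z * D.
  by move=> cz; apply/commute_sym/commute_prod=> i _; apply/commute_prod=> j _; apply/commuteX.
have cR z : (forall i j, commute z (c i j)) -> R * z = z * R.
  by move=> cz; apply/commute_sym/commute_prod=> i _; apply/commuteX.
rewrite -[LHS]mulgA [y ord_max ^+ _ * _]mulgA (@collect_gen _ _ _ _ _ (fun i => c ord_max (w i))) -/R -/B //.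
have AB : A * B = C * D.
  rewrite (IH _ _ _ (fun j i => c (w j) (w i))) //; congr (_ * _).
  apply: eq_bigr => j _; rewrite big_ord_recr /= ltnNge ltnW // mulg1; apply: eq_bigr => i _ //.
rewrite !mulgA AB -[_ * R * _]mulgA cR => [|i j]; last exact/commute_sym/commuteX.
rewrite -!mulgA; congr (_ * _); rewrite [y ord_max ^+ a _ * _]mulgA -expgnDr !mulgA.
by rewrite cD // => i j; apply/commute_sym/commuteX.
Qed.

End Collection.

Lemma expg_modn (H : groupType) (x : H) p k : x ^+ p = 1 -> x ^+ (k %% p) = x ^+ k.
Proof. by move=> xp; rewrite {2}(divn_eq k p) expgnDr mulnC expgnA xp expg1n mul1g. Qed.

Lemma val_FpD p (a b : 'F_p) : prime p -> (a + b)%R = ((a + b) %% p)%N :> nat.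
Proof. by move=> p_pr; congr (_ %% _)%N; apply: Fp_cast. Qed.

Lemma val_FpM p (a b : 'F_p) : prime p -> (a * b)%R = ((a * b) %% p)%N :> nat.
Proof. by move=> p_pr; congr (_ %% _)%N; apply: Fp_cast. Qed.

Section MorphFacts.

Variables (G H : groupType) (f : G -> H).
Hypothesis fM : {morph f : u v / u * v}.

Lemma morph_group1 : f 1 = 1.
Proof. by apply: (mulgI (f 1)); rewrite -fM !mulg1. Qed.

Lemma morph_groupV x : f x^-1 = (f x)^-1.
Proof. by apply: (mulgI (f x)); rewrite -fM !mulgV morph_group1. Qed.

Lemma morph_groupX x n : f (x ^+ n) = f x ^+ n.
Proof. by elim: n => [|n IH]; rewrite ?morph_group1 // !expgS fM IH. Qed.

Lemma morph_groupR x y : f [~ x, y] = [~ f x, f y].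
Proof. by rewrite /commg /conjg !fM !morph_groupV. Qed.

Lemma morph_group_prod I r (P : pred I) (F : I -> G) :
  f (\prod_(i <- r | P i) F i) = \prod_(i <- r | P i) f (F i).
Proof. exact: (big_morph f fM morph_group1). Qed.

End MorphFacts.

Section Universal.

Variables (p m : nat).
Hypotheses (p_pr : prime p) (p_gt2 : (2 < p)%N).
Local Notation V := 'rV['F_p]_m.+1.
Local Notation W := (alt p m.+1).

(* Since [~ y_j, y_i] is the wedge of e_j and e_i, the exponent for i < j is the
   entry (j, i) of w and not (i, j). *)
Definition wprod (H : groupType) (y : 'I_m.+1 -> H) (w : W) : H :=
  pair_prod (fun j i => [~ y j, y i]) (fun j i => if (i < j)%N then nat_of_ord (altmx w j i) else 0).

Definition rels_of (w0 : W) (H : groupType) (y : 'I_m.+1 -> H) : Prop :=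
  [/\ forall i j k, [~ [~ y i, y j], y k] = 1,
      forall i, i != ord0 -> y i ^+ p = 1 & y ord0 ^+ p = wprod y w0].

Lemma mxalt_lt (A : 'M['F_p]_m.+1) (i j : 'I_m.+1) : (i < j)%N -> altmx (mxalt A) i j = A i j.
Proof. by move=> ij; rewrite altmx_lt ffunE. Qed.

Definition class2_rels (H : groupType) (y : 'I_m.+1 -> H) : Prop :=
  (forall i j k, [~ [~ y i, y j], y k] = 1) /\ (forall i, i != ord0 -> y i ^+ p = 1).

Lemma rels_class2 w0 (H : groupType) (y : 'I_m.+1 -> H) : rels_of w0 y -> class2_rels y.
Proof. by case. Qed.

Section Class2.

Variables (H : groupType) (y : 'I_m.+1 -> H).
Hypothesis ycl : class2_rels y.

Let c j i := [~ y j, y i].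

Lemma class2_commute i j k : commute [~ y i, y j] (y k).
Proof. by case: ycl => /(_ i j k)/eqP/commgP. Qed.

Let c_y i j k : commute (c i j) (y k) := class2_commute i j k.

Lemma class2_commutators i j k l : commute [~ y i, y j] [~ y k, y l].
Proof.
have cV i' : commute [~ y i, y j] (y i')^-1 by apply/commuteV/c_y.
by rewrite {2}/commg /conjg; do !apply: commuteM => //; apply: c_y.
Qed.

Let c_c i j k l : commute (c i j) (c k l) := class2_commutators i j k l.

(** The commutator is multiplicative in its first argument here, and [i < j] rules out [j = ord0],
    so [y j] has trivial p-th power. *)
Lemma class2_exp (j i : 'I_m.+1) : (i < j)%N -> [~ y j, y i] ^+ p = 1.
Proof.
move=> ij; have yj : y j ^+ p = 1.
  by case: ycl => _; apply; apply: contraTneq ij => ->.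
have := @exchange_expg _ (y j) (y i) (c j i) p 1 (commgC _ _) (c_y _ _ _) (c_y _ _ _).
by rewrite yj mulg1 mul1g muln1 => /(canLR (mulKg _)); rewrite mulVg => <-.
Qed.

Lemma wprod_commute w k : commute (wprod y w) (y k).
Proof. by apply/commute_sym/commute_pair_prod => i j; apply/commute_sym/c_y. Qed.

Lemma wprodD w w' : wprod y (w + w')%R = wprod y w * wprod y w'.
Proof.
rewrite /wprod pair_prodM; last exact: c_c.
apply: eq_pair_prod => j i.
case: ifP => // ij; rewrite linearD mxE val_FpD //.
by rewrite expg_modn // class2_exp.
Qed.

Lemma wprod0 : wprod y 0%R = 1.
Proof. by apply: (mulgI (wprod y 0%R)); rewrite -wprodD mulg1 addr0. Qed.

Lemma wprodMn w k : wprod y (w *+ k)%R = wprod y w ^+ k.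
Proof. by elim: k => [|k IH]; rewrite ?wprod0 // mulrS wprodD IH expgS. Qed.

(** The only exponent that survives is the entry (j, i), which is -1 in F_p. As [y_j, y_i] has order
    dividing p, the power is its inverse [y_i, y_j]. *)
Lemma wprod_wedge (i j : 'I_m.+1) : (i < j)%N ->
  wprod y (wedge (delta_mx 0 i) (delta_mx 0 j))%R = [~ y i, y j].
Proof.
move=> ij; have ij0 : (i == j) = false := ltn_eqF ij.
rewrite /wprod /pair_prod (eq_bigr (fun k => if k == j then [~ y i, y j] else 1)).
  by rewrite -big_mkcond (big_pred1 j).
move=> k _; rewrite (eq_bigr (fun l => if (k == j) && (l == i) then [~ y i, y j] else 1)).
  by case: (k == j) => /=; [rewrite -big_mkcond (big_pred1 i) | rewrite big1].
move=> l _; case: ifP => lk; last first.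
  by case: ifP => // /andP[/eqP kj /eqP li]; move: lk; rewrite kj li ij.
have -> : altmx (wedge (delta_mx 0 i) (delta_mx 0 j : V))%R k l =
    (if (k == j) && (l == i) then -1 else 0 : 'F_p)%R.
  rewrite wedgeE !mxE eqxx /=; have [->|kj] := eqVneq k j.
    by rewrite [j == i]eq_sym ij0 mul0r sub0r mulr1; case: eqP; rewrite ?oppr0.
  rewrite mulr0 subr0; have [ki|_] := eqVneq k i; last by rewrite mul0r.
  have [lj|_] := eqVneq l j; last by rewrite mulr0.
  by move: lk; rewrite ki lj ltnNge ltnW.
case: andP => [[/eqP-> /eqP->]|_]; last by rewrite expg0.
have c1 : [~ y j, y i] ^+ ((-1 + 1)%R : 'F_p) = 1 by rewrite addNr.
move: c1; rewrite val_FpD // expg_modn ?class2_exp // expgnDr.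
rewrite (_ : nat_of_ord (1 : 'F_p)%R = 1%N) ?expg1; last by rewrite /= modn_small.
by move/eqP; rewrite mulg_eq1 => /eqP->; rewrite invgR.
Qed.

End Class2.

Section Target.

Variables (w0 : W) (H : groupType) (y : 'I_m.+1 -> H).

(* The ordered product of the generators in the model has second component
   sum_(i < j) x_i x_j / 2 e_i wedge e_j, which is subtracted here. *)
Definition lift_model (x : model w0) : H :=
  \prod_(i < m.+1) y i ^+ (x.1 0%R i) * wprod y (x.2 - 2^-1 *: mxalt (x.1^T *m x.1))%R.

Hypothesis yrel : rels_of w0 y.
Let ycl : class2_rels y := rels_class2 yrel.
Let c j i := [~ y j, y i].

(** Exponents may be reduced modulo p at no cost except at [ord0], where each carry releases one
    factor y_0^p, that is, one copy of [w0]. *)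
Let carry_prod (u v : V) :
  \prod_(i < m.+1) y i ^+ (u 0%R i + v 0%R i) =
  \prod_(i < m.+1) y i ^+ ((u + v)%R 0%R i) * wprod y (w0 *+ carry (u 0 0) (v 0 0))%R.
Proof.
case: yrel => _ yp y0.
rewrite !big_ord_recl /= (wprodMn ycl) -y0 mxE carryE //.
rewrite (eq_bigr (fun i => y (lift ord0 i) ^+ ((u + v)%R 0%R (lift ord0 i)))); last first.
  by move=> i _; rewrite mxE val_FpD // expg_modn // yp.
have cR z : (forall i, commute z (y i)) ->
   \prod_(i < m) y (lift ord0 i) ^+ ((u + v)%R 0%R (lift ord0 i)) * z =
   z * \prod_(i < m) y (lift ord0 i) ^+ ((u + v)%R 0%R (lift ord0 i)).
  by move=> cz; apply/commute_sym/commute_prod => i _; apply/commuteX.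
rewrite -[RHS]mulgA cR => [|i]; last first.
  by rewrite y0; apply/commute_sym/commuteX/commute_sym/(wprod_commute ycl).
rewrite mulgA; congr (_ * _); rewrite -expgnA -expgnDr {1}(divn_eq (u 0%R 0%R + v 0%R 0%R) p).
by rewrite val_FpD // [in RHS]addnC [in RHS]mulnC.
Qed.

Lemma lift_modelM : {morph lift_model : u v / u * v}.
Proof.
move=> [u w] [v t]; rewrite /lift_model modelM /=.
set q := fun u : V => (2^-1 *: mxalt (u^T *m u))%R.
rewrite -/(q u) -/(q v) -/(q (u + v)%R).
have cA z (a : V) : wprod y z * \prod_(i < m.+1) y i ^+ (a 0%R i) = \prod_(i < m.+1) y i ^+ (a 0%R i) * wprod y z.
  by apply/commute_prod => i _; apply/commuteX/(wprod_commute ycl).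
rewrite -mulgA [wprod y _ * _]mulgA cA !mulgA.
rewrite (@collect _ _ _ _ _ c (fun _ _ => commgC _ _) (class2_commute ycl) (class2_commutators ycl)).
rewrite carry_prod.
(* Collection leaves [y_j, y_i] to the power u_j v_i for i < j, which is minus u_j v_i times e_i
   wedge e_j. What remains is the polarisation of the quadratic correction [q]. *)
have -> : pair_prod c (fun j i => if (i < j)%N then (u 0%R j * v 0%R i)%N else 0) = wprod y (- mxalt (v^T *m u))%R.
  apply: eq_pair_prod => j i; case: ifP => // ij.
  rewrite altmxN linearN mxE opprK mxalt_lt // !mxE big_ord1 !mxE val_FpM //.
  by rewrite mulnC expg_modn // (class2_exp ycl).
rewrite -!mulgA -!(wprodD ycl); congr (_ * wprod y _).
have -> : wedge u v = (mxalt (u^T *m v) - mxalt (v^T *m u))%R by rewrite /wedge linearB.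
have -> : q (u + v)%R = (q u + q v + (2^-1 *: mxalt (u^T *m v) + 2^-1 *: mxalt (v^T *m u)))%R.
  rewrite /q [((u + v)^T)%R]linearD mulmxDl !mulmxDr !linearD /=.
  by rewrite [RHS](AC (2*2) ((1*3)*(4*2))).
rewrite scalerBr -[mxalt (v^T *m u) in RHS](halfD p_pr p_gt2).
move: (q u) (q v) (w0 *+ _)%R (2^-1 *: _)%R (2^-1 *: _)%R => a b d e f.
have key (r s a' b' d' e' f' : 'F_p) : (r + s + (e' - f') + d' - (a' + b' + (e' + f')) =
    d' + (- (f' + f') + (r - a' + (s - b'))))%R by ring.
by apply/ffunP=> k; rewrite !ffunE; apply: key.
Qed.

Lemma lift_model_gen i : lift_model (delta_mx 0%R i, 0%R) = y i.
Proof.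
rewrite /lift_model /= (eq_bigr (fun j => if pred1 i j then y j else 1)); last first.
  move=> j _; rewrite mxE eqxx /=; case: eqP => _; last by rewrite expg0.
  by rewrite /= ?modn_small // expg1.
rewrite -big_mkcond (big_pred1 i) //= sub0r.
rewrite (_ : mxalt _ = 0%R) ?scaler0 ?oppr0 ?(wprod0 ycl) ?mulg1 //.
apply/ffunP=> -[[j k] jk]; rewrite !ffunE !mxE big_ord1 !mxE eqxx /=.
case: eqP => [ji|]; last by rewrite mul0r.
case: eqP => [ki|_]; last by rewrite mulr0.
by move: (jk); rewrite /= ji ki ltnn.
Qed.

Lemma lift_modelZ w : lift_model (0%R, w) = wprod y w.
Proof.
rewrite /lift_model /= big1 ?mul1g; last by move=> i _; rewrite mxE expg0.
by rewrite mulmx0 linear0 scaler0 subr0.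
Qed.

End Target.

Section ModelIsPresented.

Variable w0 : W.
Local Notation M := (model w0).
Local Notation lift := (lift_model (w0 := w0)).

Definition gen (i : 'I_m.+1) : M := (delta_mx 0%R i, 0%R).

Lemma model_fst_prod I r (P : pred I) (F : I -> M) :
  (\prod_(i <- r | P i) F i).1 = (\sum_(i <- r | P i) (F i).1)%R.
Proof. exact: (big_morph (fun x : M => x.1) (fun _ _ => erefl) erefl). Qed.

Lemma centerM w w' : ((0%R, w) : M) * (0%R, w') = (0%R, (w + w')%R).
Proof. by rewrite modelM /= wedge0l scaler0 !mxE carry0 mulr0n !addr0. Qed.

Lemma center_prod I r (P : pred I) (F : I -> W) :
  \prod_(i <- r | P i) ((0%R, F i) : M) = (0%R, (\sum_(i <- r | P i) F i)%R).
Proof.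
apply/esym/(big_morph (fun w : W => (0%R, w) : M)) => // w w'.
by rewrite centerM.
Qed.

Lemma centerX w k : ((0%R, w) : M) ^+ k = (0%R, (w *+ k)%R).
Proof. by elim: k => [|k IH] //; rewrite expgS IH centerM mulrS. Qed.

Lemma wedge_basis w : (\sum_(j < m.+1) \sum_(i < m.+1)
   wedge (delta_mx 0 j : V) (delta_mx 0 i) *+ (if (i < j)%N then nat_of_ord (altmx w j i) else 0%N) = w)%R.
Proof.
apply: altmx_inj; apply/matrixP => k l.
wlog kl : k l / (k < l)%N.
  move=> wl; case: (ltngtP k l) => [|lk|/val_inj->]; first exact: wl.
    by rewrite [LHS]altmxN [RHS]altmxN wl.
  by rewrite !altmx0ii.
rewrite !linear_sum summxE (bigD1 l) //= !linear_sum summxE (bigD1 k) //= kl.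
have entry (i j : 'I_m.+1) e : (altmx (wedge 'e_j 'e_i *+ e) k l =
    ((k == j)%:R * (l == i)%:R - (l == j)%:R * (k == i)%:R) *+ e :> 'F_p)%R.
  by rewrite raddfMn mulmxnE wedgeE !mxE.
have kl0 : (k == l) = false := ltn_eqF kl.
rewrite entry !eqxx kl0 big1 => [|i /negPf ne]; last first.
  by rewrite entry [k == i]eq_sym ne kl0 mulr0 mul0r subrr mul0rn.
rewrite addr0 big1 ?addr0 => [|j /negPf ne]; last first.
  rewrite raddf_sum summxE big1 // => i _; rewrite entry [l == j]eq_sym ne mul0r subr0.
  case: eqP => [<-|]; last by rewrite mul0r mul0rn.
  case: eqP => [<-|]; last by rewrite mulr0 mul0rn.
  by rewrite ltnNge ltnW.
by rewrite mul0r mul1r sub0r mulNrn natr_Zp -altmxN.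
Qed.

(** For the images of the generators under an endomorphism, this computes its effect on the centre
    from its effect on V. *)
Lemma wprod_model (y : 'I_m.+1 -> M) w :
  wprod y w = (0%R, altact (\matrix_i (y i).1) w).
Proof.
set h := (\matrix_i _)%R.
rewrite -{2}[w]wedge_basis linear_sum /= -center_prod; apply: eq_bigr => j _.
rewrite linear_sum /= -center_prod; apply: eq_bigr => i _.
by rewrite modelR // centerX raddfMn /= altact_wedge -!rowE !rowK.
Qed.

Lemma wprod_gen w : wprod gen w = (0%R, w).
Proof.
rewrite wprod_model (_ : (\matrix_i _)%R = 1%:M%R) ?altact1 //.
by apply/matrixP => i j; rewrite !mxE eqxx eq_sym.
Qed.

Lemma Fp_vec_mulrn_p n (u : 'rV['F_p]_n) : (u *+ p = 0)%R.
Proof. by rewrite -scaler_nat pchar_Fp_0 // scale0r. Qed.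

Lemma gen_rels : rels_of w0 gen.
Proof.
split=> [i j k|i ne|].
- by rewrite !modelR //= wedge0l.
- rewrite modelX // /gen /= mxE eqxx /=.
  by rewrite eq_sym (negPf ne) muln0 div0n Fp_vec_mulrn_p mul0rn addr0.
rewrite wprod_gen modelX //= mxE !eqxx Fp_vec_mulrn_p mul0rn add0r.
have -> : nat_of_ord (1 : 'F_p)%R = 1%N by rewrite /= modn_small.
by rewrite muln1 divnn prime_gt0.
Qed.

Lemma morph_lift_model (H : groupType) (y : 'I_m.+1 -> H) (g : M -> H) x :
  {morph g : u v / u * v} -> (forall i, g (gen i) = y i) ->
  g (lift gen x) = lift y x.
Proof.
move=> gM gy; rewrite gM morph_group_prod //; congr (_ * _).
  by apply: eq_bigr => i _; rewrite morph_groupX // gy.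
rewrite /wprod /pair_prod morph_group_prod //; apply: eq_bigr => j _.
by rewrite morph_group_prod //; apply: eq_bigr => i _; rewrite morph_groupX // morph_groupR // !gy.
Qed.

(** This says that the generators generate. The endomorphism [lift gen] is injective, hence onto by
    finiteness, and it fixes every element of its own image because it fixes the generators. *)
Lemma lift_model_id x : lift gen x = x :> M.
Proof.
have fM := lift_modelM gen_rels; have fg := lift_model_gen gen_rels.
have inj : injective (lift gen).
  move=> x1 x2 E; apply: (mulgI x1^-1); rewrite mulVg.
  have : lift gen (x1^-1 * x2) = 1 by rewrite fM (morph_groupV fM) E mulVg.
  case: (x1^-1 * x2) => u w fx; have u0 : u = 0%R.
    have := congr1 fst fx; rewrite /lift_model /= wprod_gen /= model_fst_prod addr0 => <-.
    rewrite [LHS]row_sum_delta; apply: eq_bigr => i _.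
    by rewrite (modelX p_pr) [RHS]/= -scaler_nat natr_Zp.
  by move: fx; rewrite u0 lift_modelZ wprod_gen => ->.
have [z <-] : exists z, lift gen z = x by exists (invF inj x); rewrite f_invF.
exact: morph_lift_model.
Qed.

Lemma lift_model_unique (H : groupType) (y : 'I_m.+1 -> H) (g : M -> H) :
  {morph g : u v / u * v} -> (forall i, g (gen i) = y i) -> g =1 lift y.
Proof. by move=> gM gy x; rewrite -{1}[x]lift_model_id; apply: morph_lift_model. Qed.

Lemma model_presented : presented_by (@rels_of w0) M.
Proof.
exists gen; split=> [|H y yrel]; first exact: gen_rels.
exists (lift y); split; first exact: lift_modelM.
  exact: lift_model_gen.
exact: lift_model_unique.
Qed.

End ModelIsPresented.

End Universal.

Lemma presented_iso n rels (G M : groupType) :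
    @presented_by n rels G -> @presented_by n rels M ->
  exists f : G -> M, {morph f : u v / u * v} /\ bijective f.
Proof.
move=> [x [xr xU]] [y [yr yU]].
have [f [fM fx _]] := xU _ _ yr; have [g [gM gy _]] := yU _ _ xr.
exists f; split=> //; exists g.
  have [h [_ _ hU]] := xU _ _ xr => u.
  rewrite -[RHS](_ : h u = u); last by symmetry; apply: (hU id).
  by apply: (hU (g \o f)) => [a b|i] /=; rewrite ?fM ?gM // fx gy.
have [h [_ _ hU]] := yU _ _ yr => u.
rewrite -[RHS](_ : h u = u); last by symmetry; apply: (hU id).
by apply: (hU (f \o g)) => [a b|i] /=; rewrite ?gM ?fM // gy fx.
Qed.

(** * Multiple holomorphs *)

Section Transfer.

Variables (G M : finGroupType) (f : G -> M) (g : M -> G).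
Hypotheses (fM : {morph f : u v / u * v}) (fK : cancel f g) (gK : cancel g f).

Definition perm_conj (s : {perm G}) : {perm M} :=
  perm (inj_comp (can_inj fK) (inj_comp (@perm_inj _ s) (can_inj gK))).

Lemma perm_conjE s x : perm_conj s x = f (s (g x)).
Proof. by rewrite permE. Qed.

Lemma perm_conjM : {morph perm_conj : s t / s * t}.
Proof. by move=> s t; apply/permP => x; rewrite !(perm_conjE, permM) fK. Qed.

Lemma T_transfer : T G \isog T M.
Proof.
pose phi := Morphism (D := [set: {perm G}]) (in2W perm_conjM).
have phi_inj : 'injm phi.
  apply/injmP=> s t _ _ /= E; apply/permP => x.
  by have /permP/(_ (f x)) := E; rewrite !perm_conjE fK; apply: can_inj.
have phi_surj : phi @* [set: {perm G}] = [set: {perm M}].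
  apply/setP => t; rewrite inE; apply/morphimP.
  have tinj : injective (g \o t \o f) by apply: inj_comp (can_inj fK); apply: inj_comp (can_inj gK) (@perm_inj _ t).
  exists (perm tinj); rewrite ?inE //; apply/permP => x.
  by rewrite /= perm_conjE permE /= !gK.
have phi_rho : phi @* (@rho G @: [set: G]) = @rho M @: [set: M].
  rewrite morphimEsub ?subsetT // -imset_comp.
  apply/setP => t; apply/imsetP/imsetP => -[c _ ->].
    by exists (f c); rewrite ?inE //; apply/permP => x; rewrite /= perm_conjE !rhoE fM gK.
  by exists (g c); rewrite ?inE //; apply/permP => x; rewrite /= perm_conjE !rhoE fM !gK.
have phi_norm (A : {set {perm G}}) : phi @* 'N(A) = 'N(phi @* A).
  by rewrite injm_norm ?subsetT // phi_surj setTI.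
have phi_Hol : phi @* Hol G = Hol M by rewrite !Hol_norm phi_norm phi_rho.
have phi_NHol : phi @* NHol G = NHol M by rewrite /NHol phi_norm phi_Hol.
have nHN : Hol_group G <| [group of NHol G] by rewrite /normal normG subxx.
pose phi1 := restrm_morphism (subsetT [group of NHol G]) phi.
have phi1E (A : {set {perm G}}) : A \subset NHol G -> phi1 @* A = phi @* A.
  by move=> sAN; rewrite morphim_restrm (setIidPr sAN).
pose q := quotm_morphism phi1 nHN.
have injq : 'injm q by apply/injm_quotm/injm_restrm.
have := sub_isog (subxx _) injq; rewrite morphim_quotm.
by rewrite (phi1E _ (normG (Hol_group G))) (phi1E (NHol G)) ?subxx // phi_NHol phi_Hol.
Qed.

End Transfer.

Section NHolFacts.

Variable G : finGroupType.
Implicit Types (x y : G) (s theta : {perm G}).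

Lemma AutM s : s \in Aut [set: G] -> {morph s : x y / x * y}.
Proof. by move/Aut_setTP. Qed.

Lemma Aut_in_Hol s : s \in Aut [set: G] -> s \in Hol G.
Proof.
move=> As; rewrite -[s]mulg1; apply: mem_mulg => //.
by apply/imsetP; exists 1; rewrite ?inE //; apply/permP => x; rewrite rhoE perm1 mulg1.
Qed.

Lemma rho_in_Hol y : rho y \in Hol G.
Proof. by rewrite -[rho y]mul1g; apply: mem_mulg; rewrite ?group1 ?imset_f ?inE. Qed.

Lemma HolP s : s \in Hol G -> exists2 a, a \in Aut [set: G] & forall x, s x = a x * s 1.
Proof.
case/mulsgP=> a _ Aa /imsetP[c _ ->] ->; exists a => // x.
by rewrite !permM !rhoE (morph_group1 (AutM Aa)) mul1g.
Qed.

Lemma Hol_fix1 s : s \in Hol G -> s 1 = 1 -> s \in Aut [set: G].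
Proof.
case/HolP=> a Aa sa s1; rewrite (_ : s = a) //.
by apply/permP => x; rewrite sa s1 mulg1.
Qed.

(** The image of [F] is a complement of Hol(G) in NHol(G). Only elements fixing 1 need to be
    treated, since dividing by a right translation changes nothing modulo Hol(G). *)
Lemma T_isog (U : finGroupType) (F : U -> {perm G}) :
    {morph F : u v / u * v} -> (forall u, F u \in NHol G) ->
    (forall u, F u \in Hol G -> u = 1) ->
    (forall theta, theta \in NHol G -> theta 1 = 1 ->
       exists u, theta * (F u)^-1 \in Hol G) ->
  T G \isog [set: U].
Proof.
move=> FM FN FH Fsurj.
pose Fm := Morphism (D := [set: U]) (in2W FM).
have sEN : Fm @* [set: U] \subset 'N(Hol_group G).
  by apply/subsetP => _ /morphimP[u _ _ ->]; apply: FN.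
have NE : NHol G = Hol G * (Fm @* [set: U]).
  apply/eqP; rewrite eqEsubset mul_subG ?normG // andbT.
  apply/subsetP => s Ns.
  have Nt : s * (rho (s 1))^-1 \in NHol G.
    by rewrite groupM ?groupV // (subsetP (normG _)) ?rho_in_Hol.
  have t1 : (s * (rho (s 1))^-1) 1 = 1.
    by apply: (@perm_inj _ (rho (s 1))); rewrite -permM mulgKV rhoE mul1g.
  have [u Hu] := Fsurj _ Nt t1.
  set c := rho (s 1) in Hu.
  have -> : s = (s * c^-1 * (F u)^-1 * c ^ (F u)^-1) * F u by rewrite /conjg invgK !mulgA !mulgKV.
  apply: mem_mulg; last by apply/morphimP; exists u; rewrite ?inE.
  rewrite (@groupM _ (Hol_group G)) // memJ_norm ?rho_in_Hol //.
  by rewrite (@groupV _ (normaliser_group _)); apply: FN.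
have tiHE : Hol G :&: (Fm @* [set: U]) = 1.
  apply/trivgP/subsetP => s /setIP[HF /morphimP[u _ _ EF]]; move: HF; rewrite EF /= => HF.
  by rewrite [u]FH ?(morph_group1 FM) ?set11 //.
have injF : 'injm Fm.
  apply/subsetP => u; rewrite !inE /= => /eqP Fu1.
  by rewrite [u]FH ?Fu1 ?group1 //; apply: (group1 (Hol_group G)).
rewrite /T NE quotientMidl isog_sym.
have iso1 : [set: U] \isog Fm @* [set: U] by apply: sub_isog.
by apply: isog_trans iso1 (quotient_isog sEN tiHE).
Qed.

(** The product law says that [theta] conjugates the translation by [c] to an automorphism followed
    by the translation by [theta c]; the equivariance of [delta] makes [theta] normalise Aut(G).
    These two kinds of elements generate Hol(G). *)
Lemma NHol_crit theta (delta : G -> G -> G) :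
    (forall a, exists2 s, s \in Aut [set: G] & forall x, s x = x * delta a x) ->
    (forall x y, theta (x * y) = theta x * delta (theta y) (theta x) * theta y) ->
    (forall s a x, s \in Aut [set: G] -> s (delta a x) = delta (s a) (s x)) ->
  theta \in NHol G.
Proof.
move=> dA tM dE.
have NA : theta^-1 \in 'N(Aut [set: G]).
  rewrite inE; apply/subsetP => _ /imsetP[b Ab ->]; apply/Aut_setTP => x y.
  apply: (@perm_inj _ theta); rewrite tM !permM invgK !permKV !tM.
  by rewrite !(AutM Ab) dE.
rewrite inE; apply/subsetP => _ /imsetP[_ /mulsgP[a _ Aa /imsetP[c _ ->] ->] ->].
rewrite conjMg groupM //.
  by apply: Aut_in_Hol; rewrite memJ_norm // -groupV.
have [s As sE] := dA (theta c).
rewrite (_ : rho c ^ theta = s * rho (theta c)); first by rewrite groupM ?rho_in_Hol ?Aut_in_Hol.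
by apply/permP => x; rewrite /conjg !permM !rhoE tM sE permKV.
Qed.

Lemma NHol_structure theta : theta \in NHol G -> theta 1 = 1 ->
  exists psi : G -> {perm G}, [/\ forall a, psi a \in Aut [set: G],
    forall x y, theta (x * y) = psi (theta y) (theta x) * theta y,
    forall s a x, s \in Aut [set: G] -> psi (s a) (s x) = s (psi a x)
  & forall a b x, psi (a * b) x = psi a (psi b x)].
Proof.
move=> Nt t1.
pose psi a : {perm G} := (rho (theta^-1 a) ^ theta) * (rho a)^-1.
have tM x y : theta (x * y) = psi (theta y) (theta x) * theta y.
  have rhoVK a z : (rho a)^-1 z * a = z by rewrite -[LHS]rhoE permKV.
  by rewrite /psi [in RHS]permM rhoVK /conjg !permM !permK rhoE.
have psiA a : psi a \in Aut [set: G].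
  apply: Hol_fix1.
    rewrite (@groupM _ (Hol_group G)) // ?(@groupV _ (Hol_group G)) ?rho_in_Hol //.
    by rewrite memJ_norm ?rho_in_Hol.
  by apply: (mulIg a); have := tM 1 (theta^-1 a); rewrite !mul1g permKV t1 => <-.
have psiE s a x : s \in Aut [set: G] -> psi (s a) (s x) = s (psi a x).
  move=> As; pose s' := s ^ theta^-1.
  have As' : s' \in Aut [set: G].
    apply: Hol_fix1; first by rewrite memJ_norm ?Aut_in_Hol // (@groupV _ (normaliser_group _)).
    by rewrite /s' /conjg invgK !permM t1 (morph_group1 (AutM As)) -{1}t1 permK.
  have ss' z : theta (s' z) = s (theta z) by rewrite /s' /conjg invgK !permM permKV.
  apply: (mulIg (s a)); have := tM (s' (theta^-1 x)) (s' (theta^-1 a)).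
  by rewrite -(AutM As') !ss' !permKV => <-; rewrite tM !permKV (AutM As).
exists psi; split=> // a b x.
(* With [a = psi b a'], the product [a * b] is [theta] of the product of the preimages of [a'] and
   [b], and equivariance under [psi b] turns psi_a psi_b into psi_b psi_a'. The claim is then
   associativity of a triple product seen through [theta]. *)
rewrite -[a](permKV (psi b)) psiE // -[b in _ * b](permKV theta).
set a' := _ a; apply: (mulIg (psi b a' * b)).
have := tM (theta^-1 x) (theta^-1 a' * theta^-1 b).
by rewrite mulgA tM [theta (_ * theta^-1 a')]tM (AutM (psiA _)) -mulgA !permKV tM !permKV => ->.
Qed.

End NHolFacts.

(** * The multiple holomorph of the model group *)

Section ModelAut.

Variables (p m : nat).
Hypotheses (p_pr : prime p) (p_gt2 : (2 < p)%N).
Local Notation V := 'rV['F_p]_m.+1.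
Local Notation W := (alt p m.+1).
Variable w0 : W.
Local Notation M := (model w0).
Local Notation z_ w := ((0%R, w) : M).

(** With row vectors, the condition on column [ord0] says that [h] multiplies the first coordinate
    by [h ord0 ord0]; the last equation then expresses compatibility with p-th powers. *)
Definition admissible (h : 'M['F_p]_m.+1) : Prop :=
  [/\ h \in unitmx, forall i, i != ord0 -> (h i ord0 = 0)%R
    & altact h w0 = (h ord0 ord0 *: w0)%R].

Lemma mul_center (x : M) w : x * z_ w = (x.1, (x.2 + w)%R).
Proof. by rewrite modelM /= wedge0r scaler0 !mxE carryr0 mulr0n !addr0. Qed.

Lemma center_comm (x : M) w : z_ w * x = x * z_ w.
Proof. by rewrite mul_center modelM /= wedge0l scaler0 !mxE carry0 mulr0n !addr0 add0r addrC. Qed.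

Lemma split_center (x : M) : x = ((x.1, 0%R) : M) * z_ x.2.
Proof. by rewrite mul_center /= add0r; case: x. Qed.

Lemma center1 : z_ 0%R = 1. Proof. by []. Qed.

Lemma fst0_center (x : M) : (x.1 = 0)%R -> x = z_ x.2.
Proof. by case: x => u w /= ->. Qed.

(** The centre is generated by commutators of generators, because the wedges of basis vectors span
    W. *)
Lemma center_ind (P : M -> Prop) :
  P 1 -> (forall a b, P a -> P b -> P (a * b)) -> (forall a b, P [~ a, b]) ->
  forall w, P (z_ w).
Proof.
move=> P1 PM PR w; rewrite -wprod_gen //.
rewrite /wprod /pair_prod; do 2![apply: (big_ind P) => // ? _].
by set e := if _ then _ else _; elim: e => [|e IH] //; rewrite expgS; apply: PM.
Qed.

Lemma modelXp (x : M) : x ^+ p = z_ (x.1 ord0 ord0 *: w0)%R.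
Proof.
rewrite modelX //; congr (_, _); first exact: Fp_vec_mulrn_p.
rewrite mulKn ?prime_gt0 // -[(x.2 *+ p)%R]scaler_nat pchar_Fp_0 // scale0r add0r.
by rewrite -scaler_nat natr_Zp.
Qed.

Definition lin_part (s : M -> M) : 'M['F_p]_m.+1 := (\matrix_i (s (gen w0 i)).1)%R.

Lemma lin_partE (s : M -> M) x : {morph s : u v / u * v} -> (s x).1 = (x.1 *m lin_part s)%R.
Proof.
move=> sM; rewrite (lift_model_unique p_pr p_gt2 sM (fun _ => erefl)) /lift_model /=.
rewrite wprod_model //= addr0 model_fst_prod mulmx_sum_row; apply: eq_bigr => i _.
rewrite modelX //= -scaler_nat natr_Zp; congr (_ *: _)%R.
by apply/rowP => j; rewrite !mxE.
Qed.

Lemma lin_part_center (s : M -> M) w : {morph s : u v / u * v} ->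
  s (z_ w) = z_ (altact (lin_part s) w).
Proof.
by move=> sM; rewrite (lift_model_unique p_pr p_gt2 sM (fun _ => erefl)) lift_modelZ // wprod_model.
Qed.

Lemma lin_part_eq (s : M -> M) h :
  (forall x, (s x).1 = x.1 *m h)%R -> lin_part s = h.
Proof. by move=> sh; apply/row_matrixP => i; rewrite rowK sh -rowE. Qed.

Hypothesis w0_neq0 : w0 != 0%R.

Lemma Aut_admissible s : s \in Aut [set: M] -> admissible (lin_part s).
Proof.
move=> As; have sM := AutM As; have s'M := AutM (groupVr As).
split.
- have : (lin_part s *m lin_part (s^-1)%g)%R = 1%:M%R.
    apply/row_matrixP => i; rewrite rowE [RHS]rowE mulmxA mulmx1.
    by rewrite -[delta_mx _ _]/((gen w0 i).1) -(lin_partE _ sM) -(lin_partE _ s'M) permK.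
  move=> /mulmx1_unit[hU _]; exact: hU.
- move=> i ne; have [_ gp _] := gen_rels p_pr p_gt2 w0.
  have := modelXp (s (gen w0 i)); rewrite -(morph_groupX sM) (gp i ne) (morph_group1 sM).
  case=> /esym/eqP; rewrite scaler_eq0 (negPf w0_neq0) orbF (lin_partE _ sM) => /eqP.
  by rewrite [(gen w0 i).1]/= -rowE mxE.
have := modelXp (s (gen w0 ord0)); rewrite -(morph_groupX sM) modelXp.
rewrite (lin_part_center _ sM) mxE !eqxx scale1r => -[->].
by rewrite (lin_partE _ sM) [(gen w0 ord0).1]/= -rowE mxE.
Qed.

(** The lifts (row i h, 0) of the rows satisfy the defining relations, so the universal property
    gives an endomorphism. It is injective because [h] is invertible on V, and hence on W. *)
Lemma admissible_Aut h : admissible h ->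
  exists2 s, s \in Aut [set: M] & lin_part s = h.
Proof.
case=> hU h0 hw; pose y i : M := (row i h, 0%R).
have yh : (\matrix_i (y i).1)%R = h by apply/row_matrixP => i; rewrite rowK.
have yrel : rels_of w0 y.
  split=> [i j k|i ne|].
  - by rewrite !modelR //= wedge0l.
  - by rewrite modelXp /= mxE h0 // scale0r.
  by rewrite wprod_model // modelXp yh hw /= mxE.
have fM := lift_modelM p_pr p_gt2 yrel.
have fh : lin_part (lift_model (w0 := w0) y) = h.
  by apply/row_matrixP => i; rewrite rowK (lift_model_gen p_pr yrel).
have finj : injective (lift_model (w0 := w0) y).
  move=> x1 x2 E; apply: (mulgI x1^-1); rewrite mulVg.
  have : lift_model y (x1^-1 * x2) = 1 by rewrite fM (morph_groupV fM) E mulVg.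
  move: (x1^-1 * x2) => x fx.
  have x10 : (x.1 = 0)%R.
    apply: (can_inj (mulmxK hU)); rewrite mul0mx -{1}fh -(lin_partE _ fM).
    by rewrite fx.
  move: fx; rewrite (fst0_center x10) (lin_part_center _ fM) fh => -[E2].
  by rewrite -[x.2]altact1 -(mulmxV hU) altactM E2 linear0.
exists (perm finj).
  by apply/Aut_setTP => a b; rewrite !permE.
by rewrite -fh; apply/row_matrixP => i; rewrite !rowK permE.
Qed.

End ModelAut.

(** * The bilinear form attached to an element of the multiple holomorph *)

Section NormalizerElements.

Variables (p m : nat).
Hypotheses (p_pr : prime p) (p_gt2 : (2 < p)%N).
Local Notation V := 'rV['F_p]_m.+1.
Local Notation W := (alt p m.+1).
Variable w0 : W.
Hypothesis w0_neq0 : w0 != 0%R.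
Local Notation M := (model w0).
Local Notation z_ w := ((0%R, w) : M).
Local Notation v_ u := ((u, 0%R) : M).

(** The triviality of the action of psi on V, stated for the family of linear parts alone, so that
    each [w0] can be settled by matrix computations. *)
Definition rigid := forall g : V -> 'M['F_p]_m.+1,
  (forall u, admissible w0 (g u)) -> (forall u v, g (u + v) = g u *m g v)%R ->
  (forall u h, admissible w0 h -> h *m g (u *m h) = g u *m h)%R ->
  forall u, g u = 1%:M%R.

Definition equivariant (D : V -> V -> W) :=
  forall h u v, admissible w0 h -> altact h (D u v) = D (u *m h)%R (v *m h)%R.

Definition biadditive (D : V -> V -> W) :=
  (forall v, {morph (D^~ v) : u u' / (u + u')%R}) /\ (forall u, {morph (D u) : v v' / (v + v')%R}).

Lemma additive_scale (U : lmodType 'F_p) (f : V -> U) :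
  {morph f : u v / (u + v)%R} -> forall a u, (f (a *: u) = a *: f u)%R.
Proof.
move=> fD a u; have f0 : (f 0 = 0)%R by apply: (addrI (f 0%R)); rewrite -fD !addr0.
have fMn k : (f (u *+ k) = f u *+ k)%R.
  by elim: k => [|k IH]; rewrite ?f0 // !mulrS fD IH.
by rewrite -[a]natr_Zp !scaler_nat fMn.
Qed.

Section Theta.

Variable theta : {perm M}.
Hypotheses (Nt : theta \in NHol M) (t1 : theta 1 = 1) (rig : rigid).

Lemma theta_structure : exists D : V -> V -> W,
  [/\ biadditive D, equivariant D
    & forall x y, theta (x * y) = theta x * z_ (D (theta y).1 (theta x).1) * theta y].
Proof.
have [psi [psiA tM psiE psiM]] := NHol_structure Nt t1.
have psM a := AutM (psiA a).
pose G a := lin_part (psi a).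
have GE a x : (psi a x).1 = (x.1 *m G a)%R := lin_partE p_pr p_gt2 x (psM a).
have GM a b : G (a * b) = (G b *m G a)%R.
  by apply: lin_part_eq => x; rewrite psiM !GE mulmxA.
have Gunit a : G a \in unitmx by have [] := Aut_admissible p_pr p_gt2 w0_neq0 (psiA a).
have Gs s a : s \in Aut [set: M] -> (lin_part s *m G (s a) = G a *m lin_part s)%R.
  move=> As; have sM := AutM As; apply/row_matrixP => i; rewrite rowE [RHS]rowE !mulmxA.
  rewrite -[delta_mx _ _]/((gen w0 i).1) -(lin_partE p_pr p_gt2 _ sM) -!GE (psiE _ _ _ As).
  exact: lin_partE.
have G1 : G 1 = 1%:M%R.
  have := GM 1 1; rewrite mulg1 => E; rewrite -[LHS](mulmxK (Gunit 1)) -E mulmxV //.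
have conjA c : exists2 s, s \in Aut [set: M] & forall x, s x = x ^ c.
  exists (perm (conjg_inj c)); last by move=> x; rewrite permE.
  by apply/Aut_setTP => a b; rewrite !permE conjMg.
(* Inner automorphisms have trivial linear part, so equivariance makes [G] constant on conjugacy
   classes. Hence its values commute, it kills commutators and so the centre, and it descends to
   V. *)
have Gconj a c : G (a ^ c) = G a.
  have [s As sE] := conjA c; have := Gs s a As; rewrite sE.
  suff -> : lin_part s = 1%:M%R by rewrite mul1mx mulmx1.
  apply: lin_part_eq => x; rewrite sE mulmx1 -[x ^ c](mulKVg x) -commgEl modelR // mul_center.
  reflexivity.
have Gcomm a c : (G a *m G c = G c *m G a)%R.
  by rewrite -GM conjgC GM Gconj.
have GR a c : G [~ a, c] = 1%:M%R.
  have := GM a [~ a, c]; rewrite commgEl mulKVg Gconj => E.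
  by rewrite -[LHS](mulmxK (Gunit a)) -commgEl commgEl -E mulmxV.
have Gz w : G (z_ w) = 1%:M%R.
  apply: (center_ind p_pr p_gt2 (P := fun z => G z = 1%:M%R)) => // a b Ga Gb.
  by rewrite GM Ga Gb mulmx1.
have Gfst a : G a = G (v_ a.1) by rewrite {1}[a]split_center GM Gz mul1mx.
have G_id a : G a = 1%:M%R.
  rewrite Gfst; apply: (rig (g := fun u => G (v_ u))) => [u|u v|u h hadm].
  - exact: Aut_admissible.
  - by rewrite -Gcomm -GM [RHS]Gfst.
  have [s As <-] := admissible_Aut p_pr p_gt2 hadm.
  by rewrite -(Gs s (v_ u) As) [G (s _)]Gfst (lin_partE p_pr p_gt2 _ (AutM As)).
have [D0 psiD] : exists D0, forall a x, psi a x = x * z_ (D0 a x).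
  exists (fun a x => (psi a x).2 - x.2)%R => a x.
  by rewrite mul_center addrC subrK {1}[psi a x]surjective_pairing GE G_id mulmx1.
have z_inj w w' : z_ w = z_ w' -> w = w' by case.
have D0r a x y : D0 a (x * y) = (D0 a x + D0 a y)%R.
  apply/z_inj/(mulgI (x * y)); rewrite -psiD psM !psiD -centerM.
  by rewrite !mulgA -[x * _ * y]mulgA center_comm !mulgA.
have D0l a b x : D0 (a * b) x = (D0 a x + D0 b x)%R.
  apply/z_inj/(mulgI x); rewrite -psiD psiM [psi b x]psiD psM [psi a x]psiD.
  rewrite -!mulgA; congr (x * _); rewrite -centerM.
  suff -> : psi a (z_ (D0 b x)) = z_ (D0 b x) by [].
  by rewrite (lin_part_center p_pr p_gt2 _ (psM a)) -/(G a) G_id altact1.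
(* A homomorphism to an abelian group kills commutators, hence the centre. The same argument in the
   other variable makes [D0] a form on V. *)
have D0lz w x : D0 (z_ w) x = 0%R.
  apply: (center_ind p_pr p_gt2 (P := fun z => D0 z x = 0%R)) => [|a b Da Db|a b].
  - by apply: (addrI (D0 1 x)); rewrite -D0l mulg1 addr0.
  - by rewrite D0l Da Db addr0.
  by apply: (addrI (D0 (b * a) x)); rewrite -D0l -commgC !D0l addr0 addrC.
have D0rz a w : D0 a (z_ w) = 0%R.
  apply: (center_ind p_pr p_gt2 (P := fun z => D0 a z = 0%R)) => [|x y Da Db|x y].
  - by apply: (addrI (D0 a 1)); rewrite -D0r mulg1 addr0.
  - by rewrite D0r Da Db addr0.
  by apply: (addrI (D0 a (y * x))); rewrite -D0r -commgC !D0r addr0 addrC.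
have D0fst a x : D0 a x = D0 (v_ a.1) (v_ x.1).
  by rewrite {1}[a]split_center {1}[x]split_center D0l D0lz addr0 D0r D0rz addr0.
exists (fun u v => D0 (v_ u) (v_ v)); split.
- split=> [v u u'|u v v'].
    by rewrite -D0l [RHS]D0fst.
  by rewrite -D0r [RHS]D0fst.
- move=> h u v hadm; have [s As <-] := admissible_Aut p_pr p_gt2 hadm.
  have sM := AutM As; apply/z_inj/(mulgI (s (v_ v))).
  rewrite -(lin_part_center p_pr p_gt2 _ sM) -sM -psiD -(psiE _ _ _ As) psiD [D0 _ _]D0fst.
  by rewrite !(lin_partE p_pr p_gt2 _ sM).
by move=> x y; rewrite tM psiD [D0 _ _]D0fst.
Qed.

(** Compare the product law on [x * y] with the one on [(y * x) * [~ x, y]]; the second factor is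
    central and contributes no term in D. *)
Lemma theta_commutator D :
    (forall x y, theta (x * y) = theta x * z_ (D (theta y).1 (theta x).1) * theta y) ->
    biadditive D ->
  forall x y, theta [~ x, y] =
    z_ (wedge (theta x).1 (theta y).1 + D (theta y).1 (theta x).1 - D (theta x).1 (theta y).1)%R.
Proof.
move=> tM [Dl Dr].
have fstM x y : (theta (x * y)).1 = ((theta x).1 + (theta y).1)%R by rewrite tM mul_center.
have fst_z w : (theta (z_ w)).1 = 0%R.
  apply: (center_ind p_pr p_gt2 (P := fun z => (theta z).1 = 0%R)) => [|x y Hx Hy|x y].
  - by rewrite t1.
  - by rewrite fstM Hx Hy addr0.
  by apply: (addrI (theta (y * x)).1); rewrite -fstM -commgC !fstM addr0 addrC.
have D0l v : D 0%R v = 0%R by apply: (addrI (D 0%R v)); rewrite -Dl !addr0.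
move=> x y; have E := tM (y * x) [~ x, y].
have fstR : (theta [~ x, y]).1 = 0%R by rewrite modelR // fst_z.
move: E; rewrite -commgC fstR D0l (fst0_center fstR); set e := (theta _).2.
rewrite !tM center1 mulg1.
have shift a b w : a * z_ w * b = a * b * z_ w by rewrite -!mulgA center_comm.
have key (a b : M) w1 w2 w3 : a * b * z_ w1 = b * a * z_ w2 * z_ w3 ->
    w3 = (wedge a.1 b.1 + w1 - w2)%R.
  rewrite (commgC a b) modelR // -mulgA centerM -[RHS]mulgA centerM => /mulgI [->].
  by rewrite addrC addKr.
by rewrite shift [theta y * _ * _]shift => /key->.
Qed.

(** The two values of D in the commutator formula combine to leave N of the wedge, so [theta] maps
    the centre into the image of N. Being injective on a finite set, it reaches the whole centre. *)
Lemma theta_commutator_surj D (N : {linear W -> W}) :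
    (forall x y, theta (x * y) = theta x * z_ (D (theta y).1 (theta x).1) * theta y) ->
    biadditive D ->
    (forall u v, D u v = 2^-1 *: (wedge u v - N (wedge u v)))%R ->
  forall w, exists w', N w' = w.
Proof.
move=> tM Dlin DN.
have tR x y : theta [~ x, y] = z_ (N (wedge (theta x).1 (theta y).1)).
  rewrite (theta_commutator tM Dlin) !DN (wedgeC (theta y).1); congr (_, _).
  set a := wedge _ _; rewrite linearN /= opprK (addrC (- a)%R) -[(N a - a)%R]opprB.
  by rewrite scalerN -addrA -opprD (halfD p_pr p_gt2) opprB addrC subrK.
have D0l v : D 0%R v = 0%R.
  by rewrite DN wedge0l linear0 subr0 scaler0.
have tz w : exists w', theta (z_ w) = z_ (N w').
  apply: (center_ind p_pr p_gt2 (P := fun z => exists w', theta z = z_ (N w')))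
    => [|a b [wa Ea] [wb Eb]|a b].
  - by exists 0%R; rewrite t1 linear0.
  - by exists (wa + wb)%R; rewrite tM Ea Eb D0l center1 mulg1 centerM linearD.
  by exists (wedge (theta a).1 (theta b).1).
have phi_inj : injective (fun w => (theta (z_ w)).2).
  move=> w w' E; have [v Ev] := tz w; have [v' Ev'] := tz w'.
  have : theta (z_ w) = theta (z_ w') by move: E; rewrite Ev Ev' /= => ->.
  by move/perm_inj => -[].
move=> w; have [w' E] := tz (invF phi_inj w); exists w'.
by have := f_invF phi_inj w; rewrite E.
Qed.

End Theta.

End NormalizerElements.

(** In a^p - b^p the cofactor of a - b is a sum of p terms that are all congruent modulo p, so both
    factors are divisible by p. *)
Lemma eqn_mod_expp (p a b : nat) : (0 < p -> a = b %[mod p] -> a ^ p = b ^ p %[mod p ^ 2])%N.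
Proof.
move=> p_gt0; wlog le_ba : a b / (b <= a)%N.
  by move=> wl E; case: (leqP b a) => [/wl|/ltnW/wl]; [apply | move=> /(_ (esym E)) ->].
move=> E; apply/eqP; rewrite eqn_mod_dvd ?leq_exp2r // subn_exp expnS.
apply: dvdn_mul; first by rewrite -eqn_mod_dvd // E.
rewrite expn1 /dvdn -modn_summ.
rewrite (eq_bigr (fun _ => b ^ p.-1 %% p)%N) => [|i _].
  by rewrite modn_summ sum_nat_const card_ord modnMr.
rewrite -modnMml -modnXm E modnXm modnMml -expnD.
by rewrite subnK // -ltnS prednK.
Qed.

(** * Permutations realising the nondegenerate forms *)

Section Defect.

Variables (F : fieldType) (W : lmodType F) (L : {linear W -> W}) (c : F).

Definition defect (w : W) : W := (2^-1 *: (w - c^-1 *: L w))%R.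

Lemma defectD : {morph defect : w t / (w + t)%R}.
Proof.
by move=> w t; rewrite /defect -scalerDr [L (_ + _)%R]linearD [(c^-1 *: _)%R]scalerDr opprD addrACA.
Qed.

Lemma defect0 : defect 0%R = 0%R.
Proof. by rewrite /defect [L _]linear0 scaler0 subrr scaler0. Qed.

Lemma defect_linear (f : {linear W -> W}) w : (forall t, L (f t) = f (L t)) ->
  f (defect w) = defect (f w).
Proof. by move=> Lf; rewrite /defect linearZ linearB /= linearZ /= -Lf. Qed.

Lemma defect_eq0 w : (2 : F)%R != 0%R -> defect w = 0%R -> (c^-1 *: L w = w)%R.
Proof.
move=> n2 /eqP; rewrite scaler_eq0 invr_eq0 (negPf n2) subr_eq0 => /eqP wE; exact: esym.
Qed.

(** The identity behind [witness_mul], with A the wedge of x and y. The first term is the change of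
    the half wedge under L; the second is the commutator power, with exponent k(k - 1)/2, in the
    expansion of (x y)^k. *)
Lemma defect_power (A : W) : (2 : F)%R != 0%R -> c != 0%R ->
  (2^-1 *: (L (c *: (c *: A)) - c *: (c *: A)) + L ((2^-1 * c * (c - 1)) *: - A) =
   defect (c *: (c *: - A)))%R.
Proof.
rewrite /defect.
move=> n2 c0; have LZ a w : (L (a *: w) = a *: L w)%R by rewrite linearZ.
rewrite -[(- A)%R]scaleN1r !LZ; move: (L A) => B.
rewrite !scalerBr !scalerA -!scaleNr [LHS]addrAC -scalerDl [LHS]addrC.
by congr (_ *: A + _ *: B)%R; field; rewrite ?n2 ?c0.
Qed.

End Defect.

Section Witnesses.

Variables (p m : nat).
Hypotheses (p_pr : prime p) (p_gt2 : (2 < p)%N).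
Local Notation V := 'rV['F_p]_m.+1.
Local Notation W := (alt p m.+1).
Variable w0 : W.
Hypothesis w0_neq0 : w0 != 0%R.
Local Notation M := (model w0).
Local Notation z_ w := ((0%R, w) : M).

Variables (U : finGroupType) (d : U -> 'F_p) (L : U -> {linear W -> W}).
Hypotheses (dM : forall u v, d (u * v) = (d u * d v)%R) (d_neq0 : forall u, d u != 0%R).
Hypotheses (LM : forall u v w, L (u * v) w = L v (L u w)) (L1 : forall w, L 1 w = w).
Hypotheses (Lw0 : forall u, L u w0 = w0).
Hypothesis Lact : forall u h w, admissible w0 h -> L u (altact h w) = altact h (L u w).
Hypothesis dL_faithful : forall u, d u = 1%R -> (forall w, L u w = w) -> u = 1.

Definition witness_form u (a b : V) : W :=
  defect (L u) (d u) (wedge a b).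

Definition scale_center u (x : M) : M := (x.1, L u x.2).
(* d^p, unlike d, is multiplicative in d modulo the exponent p^2 of the model, and
   still represents d modulo p. *)
Definition teich u : nat := (d u ^ p)%N.

(** A power involves no wedge, and [L u] fixes the carry vector [w0]. For products of different
    elements the half wedge is altered, which is the error term of [scale_centerM]. *)
Lemma scale_centerX u x k : scale_center u (x ^+ k) = scale_center u x ^+ k.
Proof. by rewrite !modelX // /scale_center /= linearD !linearMn Lw0. Qed.

Lemma scale_centerMm u v x : scale_center (u * v) x = scale_center v (scale_center u x).
Proof. by rewrite /scale_center LM. Qed.

Lemma scale_centerM u x y : scale_center u (x * y) =
  scale_center u x * z_ (2^-1 *: (L u (wedge x.1 y.1) - wedge x.1 y.1))%R * scale_center u y.
Proof.
rewrite mul_center !modelM /scale_center /=; congr (_, _).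
rewrite !linearD linearMn Lw0 linearZ /=; congr (_ + _)%R.
by rewrite [RHS](AC (1*2*1*1) ((1*4*2)*(3*5))) /= scalerN addNr addr0.
Qed.

Lemma model_exp_p2 (x : M) : x ^+ (p ^ 2) = 1.
Proof.
by rewrite expgnA (modelXp p_pr) (modelXp p_pr) mxE scale0r.
Qed.

Lemma teichM u v (x : M) : x ^+ (teich u * teich v) = x ^+ teich (u * v).
Proof.
rewrite -(expg_modn _ (model_exp_p2 x)) -[RHS](expg_modn _ (model_exp_p2 x)).
congr (_ ^+ _); rewrite /teich -expnMn; apply: eqn_mod_expp; first exact: prime_gt0.
by rewrite dM val_FpM // modn_mod.
Qed.

Lemma teichE u : ((teich u)%:R = d u :> 'F_p)%R.
Proof. by rewrite /teich natrX -(pFrobenius_autE (pchar_Fp p_pr)) pFrobenius_aut_nat natr_Zp. Qed.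

Definition witness_fun u (x : M) : M := scale_center u (x ^+ teich u).

Lemma witness_funM u v x : witness_fun v (witness_fun u x) = witness_fun (u * v) x.
Proof. by rewrite /witness_fun -scale_centerX -expgnA teichM -scale_centerMm. Qed.

Lemma witness_fun1 x : witness_fun 1 x = x.
Proof.
have d1 : d 1 = 1%R by apply: (mulfI (d_neq0 1)); rewrite -dM !mulg1 mulr1.
rewrite /witness_fun /scale_center L1 -surjective_pairing /teich d1.
by rewrite (_ : nat_of_ord (1 : 'F_p)%R = 1%N) ?exp1n ?expg1 //= modn_small.
Qed.

Lemma witness_funK u : cancel (witness_fun u) (witness_fun u^-1).
Proof. by move=> x; rewrite witness_funM mulgV witness_fun1. Qed.

Definition witness u : {perm M} := perm (can_inj (witness_funK u)).

Lemma witnessM : {morph witness : u v / u * v}.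
Proof. by move=> u v; apply/permP => x; rewrite permM !permE witness_funM. Qed.

Lemma witness_fst u x : (witness u x).1 = (d u *: x.1)%R.
Proof. by rewrite permE /witness_fun /scale_center modelX //= -scaler_nat teichE. Qed.

Lemma witness_mul u x y : witness u (x * y) =
  witness u x * z_ (witness_form u (witness u y).1 (witness u x).1) * witness u y.
Proof.
rewrite !witness_fst !permE /witness_fun.
have cR (a b c : M) : commute c [~ a, b].
  by rewrite modelR // /commute center_comm.
rewrite (expMg_Rmul _ (cR _ _ _) (cR _ _ _)) modelR // centerX.
set k := teich u; set c := 'C(k, 2).
have scZ (a : M) w : scale_center u (a * z_ w) = scale_center u a * z_ (L u w).
  by rewrite !mul_center /scale_center /= linearD.
have key (a b : M) w1 w2 w3 : (w1 + w3 = w2)%R -> a * z_ w1 * b * z_ w3 = a * z_ w2 * b.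
  by move=> <-; rewrite -mulgA -(center_comm b) mulgA -[a * _ * z_ w3]mulgA centerM.
rewrite scZ scale_centerM; apply: key.
have Xf (z : M) : (z ^+ k).1 = (d u *: z.1)%R by rewrite modelX //= -teichE scaler_nat.
rewrite !Xf /witness_form !(wedgeZl, wedgeZr) (wedgeC y.1) -(scaler_nat c).
move: (wedge x.1 y.1) => A.
have cE : (c%:R = 2^-1 * d u * (d u - 1) :> 'F_p)%R.
  have k_gt0 : (0 < k)%N.
    rewrite expn_gt0 lt0n; apply/orP; left.
    by apply: contraNneq (d_neq0 u) => dk; apply/eqP/val_inj.
  apply: (mulfI (two_neq0 p_pr p_gt2)); rewrite -natrM mulnC.
  have := bin_ffact k 2; rewrite ffactnS ffactn1 => ->.
  rewrite natrM -subn1 natrB // teichE -mulrA mulVKf //.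
  exact: (two_neq0 p_pr p_gt2).
clearbody c k; rewrite cE; apply: defect_power => //.
exact: (two_neq0 p_pr p_gt2).
Qed.

Lemma witness_NHol u : witness u \in NHol M.
Proof.
have formD a : {morph (witness_form u a) : x y / (x + y)%R}.
  by move=> x y; rewrite /witness_form wedgeDr defectD.
have form0 a : witness_form u a 0%R = 0%R by rewrite /witness_form wedge0r defect0.
apply: (@NHol_crit _ (witness u) (fun a x : M => z_ (witness_form u a.1 x.1))) => [a|x y|s a x As].
- pose f (x : M) : M := x * z_ (witness_form u a.1 x.1).
  have fM : {morph f : x y / x * y}.
    move=> x y; rewrite /f formD mulgA -[x * _ * y]mulgA center_comm mulgA.
    by rewrite -[RHS]mulgA centerM.
  have finj : injective f.
    move=> x1 x2 E; apply: (mulgI x1^-1); rewrite mulVg.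
    have : f (x1^-1 * x2) = 1 by rewrite fM (morph_groupV fM) E mulVg.
    move: (x1^-1 * x2) => x; rewrite /f mul_center => -[x1_0].
    by rewrite x1_0 form0 addr0 => x2_0; rewrite [x]surjective_pairing x1_0 x2_0.
  exists (perm finj); last by move=> x; rewrite permE.
  by apply/Aut_setTP => x y; rewrite !permE fM.
- exact: witness_mul.
have sM := AutM As; rewrite (lin_part_center p_pr p_gt2 _ sM) !(lin_partE p_pr p_gt2 _ sM).
congr (_, _); rewrite /witness_form -altact_wedge.
apply: (@defect_linear _ _ (L u) (d u) (altact (lin_part s))) => t.
by rewrite Lact //; apply: Aut_admissible.
Qed.

(** A witness in Hol is an automorphism, so its form vanishes and [L u] is the scalar [d u]. Since
    [L u] fixes the nonzero vector [w0], this scalar is 1, and faithfulness applies. *)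
Lemma witness_Hol u : witness u \in Hol M -> u = 1.
Proof.
have w1 : witness u 1 = 1.
  by rewrite permE /witness_fun expg1n; congr (_, _); apply: linear0.
move=> /Hol_fix1 /(_ w1) /AutM wM.
have form0 a b : witness_form u a b = 0%R.
  pose x := (witness u)^-1 ((b, 0%R) : M); pose y := (witness u)^-1 ((a, 0%R) : M).
  have := wM x y; rewrite witness_mul -mulgA => /mulgI.
  rewrite -[RHS]mul1g => /mulIg [].
  by rewrite !permKV.
have Lw w : ((d u)^-1 *: L u w = w)%R.
  apply: defect_eq0; first exact: (two_neq0 p_pr p_gt2).
  rewrite -[w]wedge_basis (big_morph _ (@defectD _ _ _ _) (@defect0 _ _ _ _)).
  rewrite big1 // => j _; rewrite (big_morph _ (@defectD _ _ _ _) (@defect0 _ _ _ _)).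
  rewrite big1 // => i _; elim: (if _ then _ else _) => [|k IH]; first by rewrite mulr0n defect0.
  by rewrite mulrS defectD IH addr0; apply: form0.
have d1 : d u = 1%R.
  have /eqP := Lw w0; rewrite Lw0 -subr_eq0 -{2}[w0]scale1r -scalerBl scaler_eq0.
  rewrite (negPf w0_neq0) orbF subr_eq0.
  by move/eqP/(congr1 GRing.inv); rewrite invrK invr1.
by apply: dL_faithful => // w; have := Lw w; rewrite d1 invr1 scale1r.
Qed.

Hypothesis rig : rigid w0.
Hypothesis classify : forall D : V -> V -> W,
  biadditive D -> equivariant w0 D ->
  (forall N : {linear W -> W}, (forall u v, D u v = 2^-1 *: (wedge u v - N (wedge u v)))%R ->
     forall w, exists w', N w' = w) ->
  exists u, forall a b, D a b = witness_form u a b.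

Lemma T_model : T M \isog [set: U].
Proof.
apply: (T_isog witnessM witness_NHol witness_Hol) => theta Nt t1.
have [D [Dlin Deq tM]] := theta_structure p_pr p_gt2 w0_neq0 Nt t1 rig.
have [|u DE] := classify Dlin Deq.
  by move=> N DN; apply: (theta_commutator_surj p_pr p_gt2 t1 tM Dlin DN).
exists u; apply/Aut_in_Hol/Aut_setTP => x y.
apply: (@perm_inj _ (witness u)); rewrite witness_mul !permM !permKV tM DE.
by [].
Qed.

End Witnesses.

Local Open Scope ring_scope.

(** * Admissible diagonal maps and transvections *)

Section Tools.

Variables (p m : nat).
Hypotheses (p_pr : prime p) (p_gt2 : (2 < p)%N).
Local Notation V := 'rV['F_p]_m.+1.
Local Notation W := (alt p m.+1).
Local Notation F := 'F_p.
Local Notation e_ i := (delta_mx 0 i : V).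

Definition transv (r s : 'I_m.+1) : 'M[F]_m.+1 := 1%:M + delta_mx r s.

Lemma transv_row r s i : e_ i *m transv r s = e_ i + (i == r)%:R *: e_ s.
Proof. by rewrite mulmxDr mulmx1 mul_delta_mx_cond scaler_nat. Qed.

Lemma transv_unit r s : r != s -> transv r s \in unitmx.
Proof.
move=> rs; apply: (proj1 (@mulmx1_unit _ _ _ (1%:M - delta_mx r s) _)).
rewrite mulmxBr mulmx1 mulmxDl mul1mx mul_delta_mx_cond eq_sym (negPf rs) mulr0n addr0.
by rewrite addrK.
Qed.

Lemma transv_wedge r s a b : (r = a -> s = b) -> (r = b -> s = a) ->
  altact (transv r s) (wedge (e_ a) (e_ b)) = wedge (e_ a) (e_ b).
Proof.
move=> ra rb; rewrite altact_wedge !transv_row.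
have [ar|ar] := eqVneq a r; have [br|br] := eqVneq b r.
- by rewrite ar br !wedgexx.
- by rewrite (ra (esym ar)) scale0r addr0 scale1r wedgeDl wedgexx addr0.
- by rewrite (rb (esym br)) scale0r addr0 scale1r wedgeDr wedgexx addr0.
by rewrite !scale0r !addr0.
Qed.

Lemma transv_admissible (w0 : W) r s : r != s -> s != ord0 ->
  altact (transv r s) w0 = w0 -> admissible w0 (transv r s).
Proof.
move=> rs s0 hw; split; first exact: transv_unit.
  by move=> i i0; rewrite !mxE (negPf i0) [ord0 == s]eq_sym (negPf s0) andbF addr0.
by rewrite hw !mxE eqxx [ord0 == s]eq_sym (negPf s0) andbF addr0 scale1r.
Qed.

Lemma altact_diag (t : V) (w : W) k l : altmx (altact (diag_mx t) w) k l = t 0 k * t 0 l * altmx w k l.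
Proof.
rewrite altmx_act tr_diag_mx mul_mx_diag mxE mul_diag_mx mxE mulrAC //.
Qed.

Lemma diag_row (t : V) i : e_ i *m diag_mx t = t 0 i *: e_ i.
Proof. by rewrite -rowE row_diag_mx. Qed.

Lemma diag_wedge (t : V) a b :
  altact (diag_mx t) (wedge (e_ a) (e_ b)) = (t 0 a * t 0 b) *: wedge (e_ a) (e_ b).
Proof. by rewrite altact_wedge !diag_row wedgeZl wedgeZr scalerA. Qed.

Lemma diag_admissible (w0 : W) (t : V) : (forall i, t 0 i != 0) ->
  altact (diag_mx t) w0 = t 0 ord0 *: w0 -> admissible w0 (diag_mx t).
Proof.
move=> t0 tw; split.
- apply: (proj1 (@mulmx1_unit _ _ _ (diag_mx (\row_i (t 0 i)^-1)) _)).
  apply/matrixP => i j; rewrite mul_diag_mx !mxE.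
  by case: eqP => [->|]; rewrite ?mulr0n ?mulr0 // mulr1n divff.
- by move=> i i0; rewrite mxE (negPf i0).
by rewrite tw [diag_mx _ _ _]mxE eqxx mulr1n.
Qed.

(* Comparing entries: the diagonal gives g_ii^2 = g_ii, and the entry (a, b) gives
   2 t_a g_ab = t_b g_ab. *)
Lemma almost_diag (g : 'M[F]_m.+1) (t : V) (a b : 'I_m.+1) :
    g \in unitmx -> a != b -> (forall i j, i != j -> (i, j) != (a, b) -> g i j = 0) ->
    (forall i, t 0 i != 0) -> diag_mx t *m (g *m g) = g *m diag_mx t ->
    g a b = 0 \/ t 0 a *+ 2 != t 0 b ->
  g = 1%:M.
Proof.
move=> gU ab g0 t0 E gab.
(* Off the entry (a, b) the matrix is diagonal, so column a, and every row other than row a, has at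
   most its diagonal entry; invertibility makes that entry nonzero. *)
have g_diag i : g i i != 0.
  apply/eqP => gii; have [ia|ia] := eqVneq i a.
    have /matrixP/(_ i i) := mulVmx gU; rewrite !mxE eqxx big1 => [/esym/eqP|k _].
      by rewrite oner_eq0.
    have [->|ki] := eqVneq k i; first by rewrite gii mulr0.
    by rewrite g0 ?mulr0 // xpair_eqE ia negb_and ab orbT.
  have /matrixP/(_ i i) := mulmxV gU; rewrite !mxE eqxx big1 => [/esym/eqP|k _].
    by rewrite oner_eq0.
  have [->|ki] := eqVneq k i; first by rewrite gii mul0r.
  by rewrite g0 ?mul0r 1?eq_sym // xpair_eqE negb_and eq_sym ia.
have Eij i j : t 0 i * (g *m g) i j = g i j * t 0 j.
  by have /matrixP/(_ i j) := E; rewrite mul_diag_mx mul_mx_diag mxE [in RHS]mxE.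
have g1 i : g i i = 1.
  apply: (mulfI (g_diag i)); apply: (mulfI (t0 i)); rewrite mulr1 [RHS]mulrC -Eij; congr (_ * _).
  rewrite mxE (bigD1 i) //= big1 ?addr0 // => k ki.
  have [ia|ia] := eqVneq i a; first by rewrite (g0 k) ?mulr0 // xpair_eqE ia negb_and ab orbT.
  by rewrite (g0 i k) ?mul0r 1?eq_sym // xpair_eqE negb_and eq_sym ia.
have g_ab : g a b = 0.
  case: gab => // tab; have := Eij a b.
  rewrite mxE (bigD1 a) //= (bigD1 b) 1?eq_sym //= big1 ?addr0 => [|k /andP[ka kb]]; last first.
    rewrite (g0 a k) ?mul0r //; first by rewrite eq_sym.
    by rewrite xpair_eqE eqxx.
  rewrite !g1 mul1r mulr1 -mulr2n mulrnAr -mulrnAl mulrC => /eqP.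
  by rewrite -subr_eq0 -mulrBr mulf_eq0 subr_eq0 (negPf tab) orbF => /eqP.
apply/matrixP => i j; rewrite mxE; have [->|ij] := eqVneq i j; first exact: g1.
have [[-> ->] //|ne] := eqVneq (i, j) (a, b).
by rewrite g0.
Qed.

Section Rigid.

Variables (w0 : W) (g : V -> 'M[F]_m.+1).
Hypotheses (gA : forall u, admissible w0 (g u)) (gD : forall u v, g (u + v) = g u *m g v)
  (gE : forall u h, admissible w0 h -> h *m g (u *m h) = g u *m h).

Lemma rigid_unit u : g u \in unitmx.
Proof. by have [] := gA u. Qed.

Lemma rigid_col0 u i : i != ord0 -> g u i ord0 = 0.
Proof. by have [_ + _] := gA u; apply. Qed.

Lemma rigid_basis : (forall i, g (e_ i) = 1%:M) -> forall u, g u = 1%:M.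
Proof.
move=> ge; have g0 : g 0 = 1%:M.
  have := gD 0 0; rewrite addr0 => E.
  by rewrite -[LHS](mulmxK (rigid_unit 0)) -E mulmxV // rigid_unit.
have gn u k : g u = 1%:M -> g (u *+ k) = 1%:M.
  by move=> gu; elim: k => [|k IH] //; rewrite mulrS gD gu IH mulmx1.
move=> u; rewrite [u]row_sum_delta.
apply: (big_ind (fun v => g v = 1%:M)) => // [v v' gv gv'|i _].
  by rewrite gD gv gv' mulmx1.
by rewrite -[u 0 i]natr_Zp scaler_nat gn.
Qed.

(** The transvection h sends e_r to e_r + e_s, so equivariance at e_r reads h g(e_r) g(e_s) = g(e_r)
    h. *)
Lemma rigid_transv r s : admissible w0 (transv r s) -> g (e_ r) = 1%:M -> g (e_ s) = 1%:M.
Proof.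
move=> hA gr; have := gE (e_ r) hA; rewrite transv_row eqxx scale1r gD gr !mul1mx => E.
by rewrite -(mulKmx (_ : transv r s \in unitmx) (g (e_ s))) ?E ?mulVmx //; case: hA.
Qed.

(** An admissible map fixing e_k commutes with g(e_k). For a diagonal map this kills the entries
    between different weights; the next lemma draws the consequences for a transvection. *)
Lemma rigid_diag_comm k (t : V) i j : admissible w0 (diag_mx t) -> t 0 k = 1 ->
  t 0 i != t 0 j -> g (e_ k) i j = 0.
Proof.
move=> hA tk tij; have := gE (e_ k) hA; rewrite diag_row tk scale1r => /matrixP/(_ i j).
rewrite mul_diag_mx mul_mx_diag mxE [RHS]mxE [RHS]mulrC => /eqP.
by rewrite -subr_eq0 -mulrBl mulf_eq0 subr_eq0 (negPf tij) => /eqP.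
Qed.

Lemma rigid_transv_comm k r s : admissible w0 (transv r s) -> k != r ->
  [/\ g (e_ k) r r = g (e_ k) s s, forall l, l != s -> g (e_ k) s l = 0
    & forall l, l != r -> g (e_ k) l r = 0].
Proof.
move=> hA kr; have := gE (e_ k) hA.
rewrite transv_row (negPf kr) scale0r addr0 mulmxDl mulmxDr mul1mx mulmx1 => /addrI.
set A := g _ => E.
have L i j : (delta_mx r s *m A) i j = (i == r)%:R * A s j.
  rewrite mxE (bigD1 s) //= mxE eqxx andbT big1 ?addr0 // => k' ks.
  by rewrite mxE (negPf ks) andbF mul0r.
have R i j : (A *m delta_mx r s) i j = A i r * (j == s)%:R.
  rewrite mxE (bigD1 r) //= mxE eqxx big1 ?addr0 // => k' ks.
  by rewrite mxE (negPf ks) mulr0.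
have LR i j : (i == r)%:R * A s j = A i r * (j == s)%:R by rewrite -L -R E.
split=> [|l ls|l lr].
- by have := LR r s; rewrite !eqxx mul1r mulr1.
- by have := LR r l; rewrite eqxx (negPf ls) mul1r mulr0.
by have := LR l s; rewrite eqxx (negPf lr) mul0r mulr1.
Qed.

(** A diagonal map doubling e_k turns equivariance into diag(t) g(e_k)^2 = g(e_k) diag(t), because
    g(2 e_k) = g(e_k)^2. *)
Lemma rigid_almost_diag k (t : V) (a b : 'I_m.+1) :
    admissible w0 (diag_mx t) -> (forall i, t 0 i != 0) -> t 0 k = 2%:R -> a != b ->
    (forall i j, i != j -> (i, j) != (a, b) -> g (e_ k) i j = 0) ->
    g (e_ k) a b = 0 \/ t 0 a *+ 2 != t 0 b ->
  g (e_ k) = 1%:M.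
Proof.
move=> hA t0 tk ab g0 gab; apply: (almost_diag (t := t)) ab g0 t0 _ gab; first exact: rigid_unit.
by rewrite -(gE (e_ k) hA) diag_row tk scaler_nat mulr2n gD.
Qed.

End Rigid.

Section Classify.

Variables (w0 : W) (D : V -> V -> W).
Hypotheses (Dlin : biadditive D) (Deq : equivariant w0 D).

Lemma D_Zl a u v : D (a *: u) v = a *: D u v.
Proof. by case: Dlin => Dl _; apply: (additive_scale (f := D^~ v)). Qed.

Lemma D_Zr a u v : D u (a *: v) = a *: D u v.
Proof. by case: Dlin => _ Dr; apply: (additive_scale (f := D u)). Qed.

Lemma D_diag (t : V) i j k l : admissible w0 (diag_mx t) ->
  t 0 i * t 0 j != t 0 k * t 0 l -> altmx (D (e_ i) (e_ j)) k l = 0.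
Proof.
move=> hA tne; have := Deq (e_ i) (e_ j) hA.
rewrite !diag_row D_Zl D_Zr scalerA => /(congr1 (fun w => altmx w k l)).
rewrite altact_diag linearZ /= [RHS]mxE => /eqP.
by rewrite -subr_eq0 -mulrBl mulf_eq0 subr_eq0 eq_sym (negPf tne) => /eqP.
Qed.

Lemma D_transv r s i j : admissible w0 (transv r s) ->
  altact (transv r s) (D (e_ i) (e_ j)) =
  D (e_ i + (i == r)%:R *: e_ s) (e_ j + (j == r)%:R *: e_ s).
Proof. by move=> hA; rewrite (Deq _ _ hA) !transv_row. Qed.

End Classify.

Lemma biadditive_ext (D D' : V -> V -> W) : biadditive D -> biadditive D' ->
  (forall i j, D (e_ i) (e_ j) = D' (e_ i) (e_ j)) -> forall u v, D u v = D' u v.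
Proof.
move=> DL D'L E u v.
have step (B : V -> V -> W) : biadditive B ->
    B u v = \sum_i \sum_j u 0 i *: (v 0 j *: B (e_ i) (e_ j)).
  move=> BL; have [Bl Br] := BL.
  have B0l x : B 0 x = 0 by apply: (addrI (B 0 x)); rewrite -Bl !addr0.
  have B0r x : B x 0 = 0 by apply: (addrI (B x 0)); rewrite -Br !addr0.
  rewrite {1}[u]row_sum_delta (big_morph (B^~ v) (Bl v) (B0l v)).
  apply: eq_bigr => i _; rewrite (D_Zl BL) {1}[v]row_sum_delta.
  rewrite (big_morph (B (e_ i)) (Br _) (B0r _)) scaler_sumr.
  by apply: eq_bigr => j _; rewrite (D_Zr BL).
rewrite (step D DL) (step D' D'L); apply: eq_bigr => i _; apply: eq_bigr => j _.
by rewrite E.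
Qed.

Lemma biadditive_wedge (f : {linear W -> W}) : biadditive (fun u v => f (wedge u v)).
Proof. by split=> [v u u'|u v v']; rewrite /= ?wedgeDl ?wedgeDr linearD. Qed.

End Tools.

Lemma scale_addI (R : pzRingType) (U : lmodType R) (a b : R) (x y : U) :
  a *: (x + y) = a *: x + b *: y -> a *: y = b *: y.
Proof. by rewrite scalerDr => /addrI. Qed.

Section Scalar.

Variables (p m : nat).
Hypotheses (p_pr : prime p) (p_gt2 : (2 < p)%N).
Local Notation V := 'rV['F_p]_m.+1.
Local Notation W := (alt p m.+1).
Local Notation F := 'F_p.
Local Notation e_ i := (delta_mx 0 i : V).

Lemma wedge_delta i j k l : altmx (wedge (e_ i) (e_ j)) k l =
  (k == i)%:R * (l == j)%:R - (l == i)%:R * (k == j)%:R.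
Proof. by rewrite wedgeE !mxE. Qed.

Lemma alt_eq (w t : W) : (forall k l : 'I_m.+1, (k < l)%N -> altmx w k l = altmx t k l) -> w = t.
Proof.
move=> E; apply: altmx_inj; apply/matrixP => k l.
case: (ltngtP k l) => [kl|lk|/val_inj->]; first exact: E.
  by rewrite [LHS]altmxN [RHS]altmxN E.
by rewrite !altmx0ii.
Qed.

Lemma altmxZ a (w : W) k l : altmx (a *: w) k l = a * altmx w k l.
Proof. by rewrite linearZ /= [LHS]mxE. Qed.

Lemma altmxD (w t : W) k l : altmx (w + t) k l = altmx w k l + altmx t k l.
Proof. by rewrite linearD /= [LHS]mxE. Qed.

Variables (w0 : W) (D : V -> V -> W).
Hypotheses (Dlin : biadditive D) (Deq : equivariant w0 D).

(** Applying the transvection to D(e_r, e_k) gives a times (e_r + e_s) wedge e_k on one side and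
    D(e_r, e_k) + D(e_s, e_k) on the other; compare the terms in e_s wedge e_k. *)
Lemma D_transv_row (r s k : 'I_m.+1) a b : admissible w0 (transv p r s) ->
    r != s -> k != r -> k != s ->
    D (e_ r) (e_ k) = a *: wedge (e_ r) (e_ k) -> D (e_ s) (e_ k) = b *: wedge (e_ s) (e_ k) ->
  a = b.
Proof.
move=> hA rs kr ks Dr Ds; have := D_transv Deq r k hA.
rewrite (negPf kr) eqxx scale0r addr0 scale1r Dr; have [Dl _] := Dlin.
rewrite Dl Dr Ds linearZ /= altact_wedge !transv_row eqxx (negPf kr) scale0r addr0 scale1r wedgeDl.
move=> /scale_addI /(congr1 (fun w => altmx w s k)).
rewrite [LHS]altmxZ [RHS]altmxZ !wedge_delta !eqxx (negPf ks) [s == k]eq_sym (negPf ks).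
by rewrite mulr0 subr0 mulr1 !mulr1.
Qed.

Lemma D_transv_col (r s k : 'I_m.+1) a b : admissible w0 (transv p r s) ->
    r != s -> k != r -> k != s ->
    D (e_ k) (e_ r) = a *: wedge (e_ k) (e_ r) -> D (e_ k) (e_ s) = b *: wedge (e_ k) (e_ s) ->
  a = b.
Proof.
move=> hA rs kr ks Dr Ds; have := D_transv Deq k r hA.
rewrite (negPf kr) eqxx scale0r addr0 scale1r Dr; have [_ Dr'] := Dlin.
rewrite Dr' Dr Ds linearZ /= altact_wedge !transv_row eqxx (negPf kr) scale0r addr0 scale1r wedgeDr.
move=> /scale_addI /(congr1 (fun w => altmx w k s)).
rewrite [LHS]altmxZ [RHS]altmxZ !wedge_delta !eqxx (negPf ks) [s == k]eq_sym (negPf ks).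
by rewrite mulr0 subr0 mulr1 !mulr1.
Qed.

(** Polarisation: the transvection carries D(e_r, e_r) = 0 to D(e_r + e_s, e_r + e_s) = 0. *)
Lemma D_transv_sym (r s : 'I_m.+1) : admissible w0 (transv p r s) ->
  D (e_ r) (e_ r) = 0 -> D (e_ s) (e_ s) = 0 -> D (e_ s) (e_ r) = - D (e_ r) (e_ s).
Proof.
move=> hA Drr Dss; have := D_transv Deq r r hA.
rewrite eqxx scale1r Drr linear0; have [Dl Dr] := Dlin.
rewrite Dl !Dr Drr Dss add0r addr0 => /esym/eqP.
by rewrite addrC addr_eq0 => /eqP.
Qed.

Definition coef i j := altmx (D (e_ i) (e_ j)) i j.

(* The weights of the diagonal maps on e_i tensor e_j and e_k wedge e_l differ
   unless {i, j} = {k, l}. *)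
Definition separated := forall i j k l : 'I_m.+1, (k < l)%N ->
  (i, j) != (k, l) -> (i, j) != (l, k) ->
  exists2 t : V, admissible w0 (diag_mx t) & t 0 i * t 0 j != t 0 k * t 0 l.

Lemma D_coef : separated -> forall i j, D (e_ i) (e_ j) = coef i j *: wedge (e_ i) (e_ j).
Proof.
move=> sep i j; apply: alt_eq => k l kl.
have kl0 : (k == l) = false := ltn_eqF kl.
rewrite altmxZ wedge_delta.
have [[-> ->]|ne1] := eqVneq (i, j) (k, l).
  by rewrite !eqxx [l == k]eq_sym kl0 !(mulr0, subr0, mulr1).
have [[-> ->]|ne2] := eqVneq (i, j) (l, k).
  by rewrite !eqxx kl0 !mulr1 mul0r sub0r mulrN1 /coef -altmxN.
have [t tA tne] := sep i j k l kl ne1 ne2.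
rewrite (D_diag Dlin Deq tA tne); move: ne1 ne2; rewrite !xpair_eqE !(eq_sym i) !(eq_sym j).
rewrite -!natrM !mulnb => /negPf-> /negPf->.
by rewrite subrr mulr0.
Qed.

Lemma coef_transv (r s : 'I_m.+1) : separated -> r != s -> admissible w0 (transv p r s) ->
  coef r s = coef s r /\
  forall k, k != r -> k != s -> coef r k = coef s k /\ coef k r = coef k s.
Proof.
move=> sep rs hA; have DC := D_coef sep.
have D0 i : D (e_ i) (e_ i) = 0 by rewrite DC wedgexx scaler0.
split=> [|k kr ks].
  by rewrite /coef (D_transv_sym hA) // linearN /= [RHS]mxE -altmxN.
split; first exact: (D_transv_row hA rs kr ks (DC _ _) (DC _ _)).
exact: (D_transv_col hA rs kr ks (DC _ _) (DC _ _)).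
Qed.

Lemma D_scalar a : separated -> (forall i j, i != j -> coef i j = a) ->
  forall u v, D u v = a *: wedge u v.
Proof.
move=> sep ca; apply: biadditive_ext => //.
  by split=> [v u u'|u v v']; rewrite /= ?wedgeDl ?wedgeDr scalerDr.
move=> i j; rewrite (D_coef sep); have [->|/ca->//] := eqVneq i j.
by rewrite wedgexx !scaler0.
Qed.

End Scalar.

Section ScalarT.

Variables (p m : nat).
Hypotheses (p_pr : prime p) (p_gt2 : (2 < p)%N).
Local Notation V := 'rV['F_p]_m.+1.
Local Notation W := (alt p m.+1).
Variable w0 : W.
Hypothesis w0_neq0 : w0 != 0.
Hypothesis rig : rigid w0.
Hypothesis scalar : forall D : V -> V -> W, biadditive D -> equivariant w0 D ->
  exists a, forall u v, D u v = a *: wedge u v.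

Lemma T_scalar : T (model w0) \isog [set: {unit 'F_p}].
Proof.
pose d (u : {unit 'F_p}) : 'F_p := FinRing.uval u.
pose L (u : {unit 'F_p}) : {linear W -> W} := idfun.
apply: (@T_model p m p_pr p_gt2 w0 w0_neq0 {unit 'F_p} d L) => //.
- by move=> u; rewrite -unitfE; apply: (valP u).
- by move=> u du _; apply: val_inj.
move=> D Dlin Deq nondeg; have [a Da] := scalar Dlin Deq.
(* For 2a = 1 the form is represented by N = 0, which is not onto because W contains [w0]. *)
have a_neq : 1 - 2%:R * a != 0.
  apply/eqP => a0; have NE u v : D u v = 2^-1 *: (wedge u v - (\0 : {linear W -> W})%R (wedge u v)).
    rewrite Da /= subr0; congr (_ *: _); apply: (mulfI (two_neq0 p_pr p_gt2)).
    by rewrite mulfV ?two_neq0 //; apply/esym/eqP; rewrite -subr_eq0 a0.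
  have [w' /eqP] := nondeg _ NE w0.
  by rewrite eq_sym (negPf w0_neq0).
(* This is the value of d that solves (1 - 1/d)/2 = a. *)
have aU : (1 - 2%:R * a)^-1 \is a GRing.unit by rewrite unitrV unitfE.
exists (FinRing.unit 'F_p aU) => u v; rewrite Da /witness_form /defect /= invrK.
rewrite -{2}[wedge u v]scale1r -scalerBl scalerA; congr (_ *: _).
by rewrite opprB addrC subrK mulKf ?two_neq0.
Qed.

End ScalarT.

(** * Three and four generators *)

Section Signs.

Variables (p m : nat).
Hypotheses (p_pr : prime p) (p_gt2 : (2 < p)%N).
Local Notation V := 'rV['F_p]_m.+1.
Local Notation W := (alt p m.+1).

Definition vec (s : seq 'F_p) : V := \row_i s`_i.

Lemma vecE s i : vec s 0 i = s`_i.
Proof. by rewrite mxE. Qed.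

Definition signs (b : seq bool) : seq 'F_p := [seq (-1) ^+ nat_of_bool x | x <- b].

Lemma sign_neq (b : bool) : b -> (1 : 'F_p) != (-1) ^+ b.
Proof.
by case: b => // _; rewrite expr1 -addr_eq0 -mulr2n (two_neq0 p_pr p_gt2).
Qed.

(** For diagonal maps with entries 1 and -1, two products of weights differ exactly when the
    exclusive or of the four sign bits is true. Indices are natural numbers so that the test
    evaluates by computation. *)
Definition sep_check (bs : seq (seq bool)) : bool :=
  let r := iota 0 m.+1 in
  all (fun i => all (fun j => all (fun k => all (fun l =>
    [|| l <= k, (i == k) && (j == l), (i == l) && (j == k) |
        has (fun b : seq bool =>
          nth false b i (+) nth false b j (+) nth false b k (+) nth false b l) bs])%N r) r) r) r.

Lemma sign_separated (w0 : W) bs : sep_check bs ->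
  (forall b, b \in bs -> size b = m.+1 /\ admissible w0 (diag_mx (vec (signs b)))) -> separated w0.
Proof.
move=> chk bsA i j k l kl ijkl ijlk.
have mem (x : 'I_m.+1) : nat_of_ord x \in iota 0 m.+1 by rewrite mem_iota add0n ltn_ord.
have := chk; rewrite /sep_check.
move=> /allP/(_ _ (mem i))/allP/(_ _ (mem j))/allP/(_ _ (mem k))/allP/(_ _ (mem l)).
rewrite leqNgt kl; move: ijkl ijlk; rewrite !xpair_eqE -!val_eqE /= => /negPf-> /negPf->.
case/hasP => b /bsA[sb hA] odd_b; exists (vec (signs b)) => //.
have tE (x : 'I_m.+1) : vec (signs b) 0 x = (-1) ^+ nth false b x.
  by rewrite vecE (nth_map false) // sb.
rewrite !tE -!signr_addb.
rewrite -(inj_eq (mulIf (_ : (-1) ^+ (nth false b i (+) nth false b j) != 0))) ?signr_eq0 //.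
rewrite -!signr_addb addbb expr0; apply: sign_neq.
by move: odd_b; case: (nth _ _ i); case: (nth _ _ j); case: (nth _ _ k); case: (nth _ _ l).
Qed.

End Signs.

Arguments vec {p m} s.

(** * Three generators: cases (a) and (b) *)

Section Three.

Variables (p : nat).
Hypotheses (p_pr : prime p) (p_gt2 : (2 < p)%N).
Local Notation F := 'F_p.
Let o0 : 'I_3 := @Ordinal 3 0 isT.
Let o1 : 'I_3 := @Ordinal 3 1 isT.
Let o2 : 'I_3 := @Ordinal 3 2 isT.
Local Notation e_ i := (delta_mx 0 i : 'rV['F_p]_3).

Lemma ord3_ind (P : 'I_3 -> Prop) : P o0 -> P o1 -> P o2 -> forall i, P i.
Proof.
by move=> P0 P1 P2 [[|[|[|i]]] hi] //; [move: P0|move: P1|move: P2]; congr P; apply: val_inj.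
Qed.

Lemma o0E : o0 = ord0. Proof. exact: val_inj. Qed.

Definition wa : alt p 3 := wedge (e_ o0) (e_ o1).
Definition wb : alt p 3 := wedge (e_ o1) (e_ o2).

Lemma wa_diag (x y z : F) : x != 0 -> y = 1 -> z != 0 -> admissible wa (diag_mx (vec [:: x; y; z])).
Proof.
move=> x0 -> z0; apply: diag_admissible.
  by apply: ord3_ind; rewrite vecE ?oner_eq0.
by rewrite diag_wedge !vecE mulr1.
Qed.

Lemma wb_diag (x y z : F) : x = y * z -> y != 0 -> z != 0 -> admissible wb (diag_mx (vec [:: x; y; z])).
Proof.
move=> -> y0 z0; apply: diag_admissible.
  by apply: ord3_ind; rewrite vecE ?mulf_neq0.
by rewrite diag_wedge !vecE.
Qed.

Lemma wa_transv r s : (r, s) \in [:: (o0, o1); (o2, o1)] -> admissible wa (transv p r s).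
Proof.
by rewrite !inE => /orP[] /eqP[-> ->]; apply: transv_admissible => //; apply: transv_wedge.
Qed.

Lemma wb_transv r s : (r, s) \in [:: (o0, o1); (o0, o2); (o1, o2); (o2, o1)] -> admissible wb (transv p r s).
Proof.
by rewrite !inE => /or4P[] /eqP[-> ->]; apply: transv_admissible => //; apply: transv_wedge.
Qed.

Lemma m1_neq0 : (-1 : F) != 0. Proof. by rewrite oppr_eq0 oner_eq0. Qed.
Lemma m1_neq1 : ((-1 : F) == 1) = false.
Proof. by have := @sign_neq p p_pr p_gt2 true isT; rewrite expr1 eq_sym => /negPf. Qed.
Lemma one_neqm1 : ((1 : F) == -1) = false.
Proof. by rewrite eq_sym m1_neq1. Qed.

Lemma wa_separated : separated wa.
Proof.
apply: (sign_separated p_pr p_gt2 (bs := [:: [:: true; false; false]; [:: false; false; true]])) => //.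
by move=> b; rewrite !inE => /orP[] /eqP->; split=> //; apply: wa_diag; rewrite ?expr1 ?m1_neq0 ?oner_eq0.
Qed.

Lemma wb_separated : separated wb.
Proof.
apply: (sign_separated p_pr p_gt2 (bs := [:: [:: true; true; false]; [:: true; false; true]])) => //.
by move=> b; rewrite !inE => /orP[] /eqP->; split=> //; apply: wb_diag; rewrite ?expr1 ?m1_neq0 ?oner_eq0 ?mulr1 ?mul1r.
Qed.

Lemma wa_scalar (D : 'rV['F_p]_3 -> 'rV['F_p]_3 -> alt p 3) : biadditive D -> equivariant wa D ->
  exists a, forall u v, D u v = a *: wedge u v.
Proof.
move=> Dl De; exists (coef D o0 o1); apply: (D_scalar Dl De wa_separated).
have [//|s01 c01] := coef_transv Dl De wa_separated _ (@wa_transv o0 o1 isT).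
have [//|s21 c21] := coef_transv Dl De wa_separated _ (@wa_transv o2 o1 isT).
have [c01_2 c01_2'] := c01 o2 isT isT.
have [c21_0 c21_0'] := c21 o0 isT isT.
by apply: ord3_ind; apply: ord3_ind => //; congruence.
Qed.

Lemma wb_scalar (D : 'rV['F_p]_3 -> 'rV['F_p]_3 -> alt p 3) : biadditive D -> equivariant wb D ->
  exists a, forall u v, D u v = a *: wedge u v.
Proof.
move=> Dl De; exists (coef D o0 o1); apply: (D_scalar Dl De wb_separated).
have [//|s01 c01] := coef_transv Dl De wb_separated _ (@wb_transv o0 o1 isT).
have [//|s02 c02] := coef_transv Dl De wb_separated _ (@wb_transv o0 o2 isT).
have [c01_2 c01_2'] := c01 o2 isT isT.
have [c02_1 c02_1'] := c02 o1 isT isT.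
by apply: ord3_ind; apply: ord3_ind => //; congruence.
Qed.

Lemma two_F0 : (2 : F) != 0. Proof. exact: (two_neq0 p_pr p_gt2). Qed.

(** The transvections between e_1 and e_2 fix e_0, so commutation with them makes g(e_0) diagonal. A
    diagonal map doubling e_0 then makes it the identity, and transvections starting at e_0 reach
    the other basis vectors. *)
Lemma wb_rigid : rigid wb.
Proof.
move=> g gA gD gE.
have g0 : g (e_ o0) = 1%:M.
  have [_ r12 c12] := rigid_transv_comm gE (k := o0) (wb_transv (r := o1) (s := o2) isT) isT.
  have [_ r21 c21] := rigid_transv_comm gE (k := o0) (wb_transv (r := o2) (s := o1) isT) isT.
  apply: (rigid_almost_diag gA gD gE (k := o0) (t := vec [:: 2; 2; 1]) (a := o0) (b := o1)) => //.
  - by apply: wb_diag; rewrite ?mulr1 ?two_F0 ?oner_eq0.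
  - by apply: ord3_ind; rewrite vecE ?two_F0 ?oner_eq0.
  - by rewrite vecE.
  - by apply: ord3_ind; apply: ord3_ind => // _ _; rewrite ?r12 ?c12 ?r21 ?c21.
  by left; apply: c12.
apply: (rigid_basis gA gD); apply: ord3_ind => //.
  exact: (rigid_transv gD gE (wb_transv (r := o0) (s := o1) isT) g0).
exact: (rigid_transv gD gE (wb_transv (r := o0) (s := o2) isT) g0).
Qed.

(** Used for h = g(e_2), whose entry (1, 2) is invisible to diagonal maps fixing e_2, as these give
    e_1 and e_2 the same weight. The eigenvector condition on [wa] excludes it, since h_00 is
    nonzero. *)
Lemma wa_adm02 h : admissible wa h -> h o0 o0 * h o1 o2 = 0.
Proof.
case=> hU h0 /(congr1 (fun w => altmx w o0 o2)).
rewrite altact_wedge wedgeE altmxZ wedge_delta /= !(mulr0n, mulr0, subr0) -!rowE !mxE => E.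
have h10 : h o1 o0 = 0 by rewrite o0E h0.
by move: E; rewrite h10 mulr0 subr0.
Qed.

Hypothesis p_gt4 : (4 < p)%N.

Lemma three_F0 : (3 : F) != 0.
Proof. by rewrite natrFp_eq0 // gtnNdvd // ltnW. Qed.

Lemma four_neq1 : (2 : F) *+ 2 != 1.
Proof. by rewrite -subr_eq0 (_ : _ - 1 = 3) ?three_F0 //; ring. Qed.

(** The transvections at hand only lead into e_1, so e_0 and e_2 are treated separately. In each
    case one entry in column 1 is left, and it vanishes because 4 differs from 1 in F_p. *)
Lemma wa_rigid : rigid wa.
Proof.
move=> g gA gD gE.
have m10 := m1_neq0; have ne1 := m1_neq1; have ne2 := one_neqm1.
have n10 : (1 : F) != 0 := oner_neq0 _.
have g0 : g (e_ o0) = 1%:M.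
  apply: (rigid_almost_diag gA gD gE (k := o0) (t := vec [:: 2; 1; 1]) (a := o0) (b := o1)) => //.
  - by apply: wa_diag; rewrite ?two_F0.
  - by apply: ord3_ind; rewrite vecE ?two_F0.
  - by rewrite vecE.
  - have hA : admissible wa (diag_mx (vec [:: 1; 1; -1])) by apply: wa_diag.
    have := rigid_diag_comm gE (k := o0) hA; rewrite vecE => /(_ _ _ (erefl _)) E.
    apply: ord3_ind; apply: ord3_ind => // _ _;
      first [by rewrite o0E (rigid_col0 gA) | by apply: E; rewrite !vecE /= ?ne1 ?ne2].
  by right; rewrite !vecE; apply: four_neq1.
have g2 : g (e_ o2) = 1%:M.
  apply: (rigid_almost_diag gA gD gE (k := o2) (t := vec [:: 1; 1; 2]) (a := o2) (b := o1)) => //.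
  - by apply: wa_diag; rewrite ?two_F0.
  - by apply: ord3_ind; rewrite vecE ?two_F0.
  - by rewrite vecE.
  - have hA : admissible wa (diag_mx (vec [:: -1; 1; 1])) by apply: wa_diag.
    have := rigid_diag_comm gE (k := o2) hA; rewrite vecE => /(_ _ _ (erefl _)) E.
    have g12 : g (e_ o2) o1 o2 = 0.
      have /eqP := wa_adm02 (gA (e_ o2)); rewrite mulf_eq0 => /orP[/eqP g00|/eqP //].
      have /matrixP/(_ o0 o0) := mulVmx (rigid_unit gA (e_ o2)); rewrite !mxE big1 => [/esym/eqP|k _].
        by rewrite oner_eq0.
      have [->|ko] := eqVneq k o0; first by rewrite g00 mulr0.
      by have -> : g (e_ o2) k o0 = 0; [rewrite o0E (rigid_col0 gA) -?o0E | rewrite mulr0].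
    apply: ord3_ind; apply: ord3_ind => // _ _;
      first [exact: g12 | by apply: E; rewrite !vecE /= ?ne1 ?ne2].
  by right; rewrite !vecE; apply: four_neq1.
apply: (rigid_basis gA gD); apply: ord3_ind => //.
exact: (rigid_transv gD gE (wa_transv (r := o0) (s := o1) isT) g0).
Qed.

End Three.

Lemma altact_wedge2 p n (h : 'M['F_p]_n) a b c d :
  altact h (wedge a b + wedge c d) = wedge (a *m h) (b *m h) + wedge (c *m h) (d *m h).
Proof. by rewrite altactD !altact_wedge. Qed.

Lemma altact_eigenD p n (h : 'M['F_p]_n) c (w t : alt p n) :
  altact h w = c *: w -> altact h t = c *: t -> altact h (w + t) = c *: (w + t).
Proof. by move=> hw ht; rewrite altactD hw ht [RHS]scalerDr. Qed.

(** * Four generators: cases (c) and (d), and the vector of case (e) *)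

Section Four.

Variables (p : nat).
Hypotheses (p_pr : prime p) (p_gt2 : (2 < p)%N).
Local Notation F := 'F_p.
Let o0 : 'I_4 := @Ordinal 4 0 isT.
Let o1 : 'I_4 := @Ordinal 4 1 isT.
Let o2 : 'I_4 := @Ordinal 4 2 isT.
Let o3 : 'I_4 := @Ordinal 4 3 isT.
Local Notation e_ i := (delta_mx 0 i : 'rV['F_p]_4).

Lemma ord4_ind (P : 'I_4 -> Prop) : P o0 -> P o1 -> P o2 -> P o3 -> forall i, P i.
Proof.
by move=> P0 P1 P2 P3 [[|[|[|[|i]]]] hi] //; [move: P0|move: P1|move: P2|move: P3]; congr P; apply: val_inj.
Qed.

Lemma ord4_0E : o0 = ord0. Proof. exact: val_inj. Qed.

Definition wc : alt p 4 := wedge (e_ o0) (e_ o1).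
Definition wd : alt p 4 := wedge (e_ o2) (e_ o3).
Definition we : alt p 4 := wc + wd.

Lemma wc_diag (x y z t : F) : x != 0 -> y = 1 -> z != 0 -> t != 0 ->
  admissible wc (diag_mx (vec [:: x; y; z; t])).
Proof.
move=> x0 -> z0 t0; apply: diag_admissible.
  by apply: ord4_ind; rewrite vecE ?oner_eq0.
by rewrite diag_wedge !vecE mulr1.
Qed.

Lemma wd_diag (x y z t : F) : x = z * t -> y != 0 -> z != 0 -> t != 0 ->
  admissible wd (diag_mx (vec [:: x; y; z; t])).
Proof.
move=> -> y0 z0 t0; apply: diag_admissible.
  by apply: ord4_ind; rewrite vecE ?mulf_neq0.
by rewrite diag_wedge !vecE.
Qed.

Lemma we_diag (x y z t : F) : x = z * t -> y = 1 -> z != 0 -> t != 0 ->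
  admissible we (diag_mx (vec [:: x; y; z; t])).
Proof.
move=> -> -> z0 t0; apply: diag_admissible.
  by apply: ord4_ind; rewrite vecE ?mulf_neq0 ?oner_eq0.
apply: altact_eigenD; first by rewrite diag_wedge !vecE mulr1.
by rewrite diag_wedge !vecE.
Qed.

Lemma wc_transv r s : (r, s) \in [:: (o0, o1); (o2, o1); (o3, o1); (o2, o3)] ->
  admissible wc (transv p r s).
Proof.
by rewrite !inE => /or4P[] /eqP[-> ->]; apply: transv_admissible => //; apply: transv_wedge.
Qed.

Lemma wd_transv r s :
  (r, s) \in [:: (o0, o1); (o0, o2); (o0, o3)] ++ [:: (o1, o2); (o2, o3); (o3, o2)] ->
  admissible wd (transv p r s).
Proof.
rewrite mem_cat => /orP[]; rewrite !inE => /or3P[] /eqP[-> ->];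
  by apply: transv_admissible => //; apply: transv_wedge.
Qed.

Lemma we_transv r s : (r, s) \in [:: (o0, o1); (o2, o3); (o3, o2)] -> admissible we (transv p r s).
Proof.
rewrite !inE => /or3P[] /eqP[-> ->]; apply: transv_admissible => //;
  by rewrite /we altactD; congr (_ + _); apply: transv_wedge.
Qed.

Let two0 : (2 : F) != 0 := two_neq0 p_pr p_gt2.
Let m10 : (-1 : F) != 0 := m1_neq0 p.
Let ne1 : ((-1 : F) == 1) = false := m1_neq1 p_pr p_gt2.
Let ne2 : ((1 : F) == -1) = false := one_neqm1 p_pr p_gt2.
Let n10 : (1 : F) != 0 := oner_neq0 _.

Lemma wc_separated : separated wc.
Proof.
apply: (sign_separated p_pr p_gt2 (bs := [:: [:: true; false; false; false];
  [:: false; false; true; false]; [:: false; false; false; true]])) => //.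
by move=> b; rewrite !inE => /or3P[] /eqP->; split=> //; apply: wc_diag; rewrite ?expr1.
Qed.

Lemma wd_separated : separated wd.
Proof.
apply: (sign_separated p_pr p_gt2 (bs := [:: [:: false; true; false; false];
  [:: true; false; true; false]; [:: true; false; false; true]])) => //.
by move=> b; rewrite !inE => /or3P[] /eqP->; split=> //; apply: wd_diag; rewrite ?expr1 ?mulr1 ?mul1r.
Qed.

Lemma wc_scalar (D : 'rV['F_p]_4 -> 'rV['F_p]_4 -> alt p 4) : biadditive D -> equivariant wc D ->
  exists a, forall u v, D u v = a *: wedge u v.
Proof.
move=> Dl De; exists (coef D o0 o1); apply: (D_scalar Dl De wc_separated).
have [//|s01 c01] := coef_transv Dl De wc_separated _ (@wc_transv o0 o1 isT).
have [//|s21 c21] := coef_transv Dl De wc_separated _ (@wc_transv o2 o1 isT).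
have [//|s31 c31] := coef_transv Dl De wc_separated _ (@wc_transv o3 o1 isT).
have [a1 a1'] := c01 o2 isT isT.
have [a2 a2'] := c01 o3 isT isT.
have [b1 b1'] := c21 o0 isT isT.
have [b2 b2'] := c21 o3 isT isT.
have [d1 d1'] := c31 o0 isT isT.
have [d2 d2'] := c31 o2 isT isT.
by apply: ord4_ind; apply: ord4_ind => //; congruence.
Qed.

Lemma wd_scalar (D : 'rV['F_p]_4 -> 'rV['F_p]_4 -> alt p 4) : biadditive D -> equivariant wd D ->
  exists a, forall u v, D u v = a *: wedge u v.
Proof.
move=> Dl De; exists (coef D o0 o1); apply: (D_scalar Dl De wd_separated).
have [//|s01 c01] := coef_transv Dl De wd_separated _ (@wd_transv o0 o1 isT).
have [//|s02 c02] := coef_transv Dl De wd_separated _ (@wd_transv o0 o2 isT).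
have [//|s03 c03] := coef_transv Dl De wd_separated _ (@wd_transv o0 o3 isT).
have [a1 a1'] := c01 o2 isT isT.
have [a2 a2'] := c01 o3 isT isT.
have [b1 b1'] := c02 o1 isT isT.
have [b2 b2'] := c02 o3 isT isT.
have [d1 d1'] := c03 o1 isT isT.
have [d2 d2'] := c03 o2 isT isT.
by apply: ord4_ind; apply: ord4_ind => //; congruence.
Qed.

Lemma wd_rigid : rigid wd.
Proof.
move=> g gA gD gE.
have g0 : g (e_ o0) = 1%:M.
  have [_ r12 c12] := rigid_transv_comm gE (k := o0) (wd_transv (r := o1) (s := o2) isT) isT.
  have [_ r23 c23] := rigid_transv_comm gE (k := o0) (wd_transv (r := o2) (s := o3) isT) isT.
  have [_ r32 c32] := rigid_transv_comm gE (k := o0) (wd_transv (r := o3) (s := o2) isT) isT.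
  apply: (rigid_almost_diag gA gD gE (k := o0) (t := vec [:: 2; 1; 2; 1]) (a := o0) (b := o1)) => //.
  - by apply: wd_diag; rewrite ?mulr1.
  - by apply: ord4_ind; rewrite vecE.
  - by rewrite vecE.
  - apply: ord4_ind; apply: ord4_ind => // _ _; rewrite ?r12 ?c12 ?r23 ?c23 ?r32 ?c32 //.
    by rewrite ord4_0E (rigid_col0 gA).
  by left; apply: c12.
apply: (rigid_basis gA gD); apply: ord4_ind => //.
- exact: (rigid_transv gD gE (wd_transv (r := o0) (s := o1) isT) g0).
- exact: (rigid_transv gD gE (wd_transv (r := o0) (s := o2) isT) g0).
exact: (rigid_transv gD gE (wd_transv (r := o0) (s := o3) isT) g0).
Qed.

Lemma wc_adm02 h : admissible wc h -> h o0 o0 * h o1 o2 = 0.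
Proof.
case=> hU h0 /(congr1 (fun w => altmx w o0 o2)).
rewrite altact_wedge wedgeE altmxZ wedge_delta /= !(mulr0n, mulr0, subr0) -!rowE !mxE => E.
have h10 : h o1 o0 = 0 by rewrite ord4_0E h0.
by move: E; rewrite h10 mulr0 subr0.
Qed.

Hypothesis p_gt4 : (4 < p)%N.
Let four1 : (2 : F) *+ 2 != 1 := four_neq1 p_pr p_gt4.

Lemma wc_rigid : rigid wc.
Proof.
move=> g gA gD gE.
have g0 : g (e_ o0) = 1%:M.
  apply: (rigid_almost_diag gA gD gE (k := o0) (t := vec [:: 2; 1; 1; 1]) (a := o0) (b := o1)) => //.
  - by apply: wc_diag.
  - by apply: ord4_ind; rewrite vecE.
  - by rewrite vecE.
  - have := rigid_diag_comm gE (k := o0) (@wc_diag 1 1 (-1) 1 n10 (erefl _) m10 n10);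
      rewrite vecE => /(_ _ _ (erefl _)) E.
    have := rigid_diag_comm gE (k := o0) (@wc_diag 1 1 1 (-1) n10 (erefl _) n10 m10);
      rewrite vecE => /(_ _ _ (erefl _)) E'.
    by apply: ord4_ind; apply: ord4_ind => // _ _; first [by rewrite ord4_0E (rigid_col0 gA)
      | by apply: E; rewrite !vecE /= ?ne1 ?ne2 | by apply: E'; rewrite !vecE /= ?ne1 ?ne2].
  by right; rewrite !vecE; apply: four1.
have g2 : g (e_ o2) = 1%:M.
  apply: (rigid_almost_diag gA gD gE (k := o2) (t := vec [:: 1; 1; 2; 1]) (a := o2) (b := o1)) => //.
  - by apply: wc_diag.
  - by apply: ord4_ind; rewrite vecE.
  - by rewrite vecE.
  - have := rigid_diag_comm gE (k := o2) (@wc_diag (-1) 1 1 1 m10 (erefl _) n10 n10);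
      rewrite vecE => /(_ _ _ (erefl _)) E.
    have := rigid_diag_comm gE (k := o2) (@wc_diag 1 1 1 (-1) n10 (erefl _) n10 m10);
      rewrite vecE => /(_ _ _ (erefl _)) E'.
    have g12 : g (e_ o2) o1 o2 = 0.
      have /eqP := wc_adm02 (gA (e_ o2)); rewrite mulf_eq0 => /orP[/eqP g00|/eqP //].
      have /matrixP/(_ o0 o0) := mulVmx (rigid_unit gA (e_ o2)); rewrite !mxE big1 => [/esym/eqP|k _].
        by rewrite oner_eq0.
      have [->|ko] := eqVneq k o0; first by rewrite g00 mulr0.
      by have -> : g (e_ o2) k o0 = 0; [rewrite ord4_0E (rigid_col0 gA) -?ord4_0E | rewrite mulr0].
    by apply: ord4_ind; apply: ord4_ind => // _ _; first [exact: g12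
      | by apply: E; rewrite !vecE /= ?ne1 ?ne2 | by apply: E'; rewrite !vecE /= ?ne1 ?ne2].
  by right; rewrite !vecE; apply: four1.
apply: (rigid_basis gA gD); apply: ord4_ind => //.
  exact: (rigid_transv gD gE (wc_transv (r := o0) (s := o1) isT) g0).
exact: (rigid_transv gD gE (wc_transv (r := o2) (s := o3) isT) g2).
Qed.

End Four.

(** * Endomorphisms acting by scalars on a line and on its complement *)

Section Twist.

Variables (F : fieldType) (W : lmodType F) (om : {scalar W}) (e : W).
Hypotheses (om_e : om e = 2%:R) (two0 : (2%:R : F) != 0).

(** As [om e] is 2, W is the sum of the line of [e] and the kernel of [om]; the map is a on the
    kernel and a + 2b on the line. *)
Definition twist (a b : F) (w : W) : W := a *: w + (b * om w) *: e.

Lemma twist_is_linear a b : linear (twist a b).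
Proof.
move=> c w t; rewrite /twist linearP /= !scalerDr mulrDr scalerDl !scalerA addrACA.
by rewrite (mulrC a c) (mulrCA b c).
Qed.
HB.instance Definition _ a b := GRing.isLinear.Build F W W _ (twist a b) (twist_is_linear a b).

Lemma twistN a b w : twist a b (- w) = - twist a b w.
Proof. exact: linearN. Qed.

Lemma om_twist a b w : om (twist a b w) = (a + 2%:R * b) * om w.
Proof. by rewrite /twist linearD !linearZ /= om_e; ring. Qed.

Lemma twistM a b c d w : twist a b (twist c d w) = twist (a * c) (a * d + b * (c + 2%:R * d)) w.
Proof.
rewrite {1}/twist om_twist /twist scalerDr !scalerA -addrA -scalerDl.
by congr (_ + _ *: _); ring.
Qed.

Lemma twist_e a b : twist a b e = (a + 2%:R * b) *: e.
Proof. by rewrite /twist om_e -scalerDl [b * _]mulrC. Qed.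

Lemma twist10 w : twist 1 0 w = w.
Proof. by rewrite /twist scale1r mul0r scale0r addr0. Qed.

Lemma twist_comm (f : {linear W -> W}) c a b w :
  f e = c *: e -> om (f w) = c * om w -> twist a b (f w) = f (twist a b w).
Proof.
move=> fe fom; rewrite /twist linearD !linearZ /= fe fom scalerA.
by congr (_ + _ *: _); ring.
Qed.

Lemma scale_twist c a b w : c *: twist a b w = twist (c * a) (c * b) w.
Proof. by rewrite /twist scalerDr !scalerA mulrA. Qed.

(** Dividing by the eigenvalue on [e] leaves a twist that fixes [e], as the maps L of the witnesses
    must fix [w0]. *)
Lemma twist_normalize a b w (nu := a + 2%:R * b) : nu != 0 ->
  twist a b w = nu *: twist (a / nu) (2^-1 * (1 - a / nu)) w.
Proof.
move=> nu0; rewrite scale_twist; congr (twist _ _ w); first by rewrite mulrC divfK.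
by rewrite mulrCA mulrBr mulr1 [nu * (a / nu)]mulrC divfK // addrC addKr mulKf.
Qed.

Lemma half_sub_twist a b w :
  2^-1 *: (w - twist (1 - 2%:R * a) (- 2%:R * b) w) = twist a b w.
Proof.
rewrite /twist opprD addrA -{1}[w]scale1r -scalerBl -scaleNr scalerDr !scalerA.
by congr (_ *: _ + _ *: _); field.
Qed.

End Twist.

Lemma scale_sum_left (R : pzRingType) (U : lmodType R) (a b c d : R) (x y : U) :
  a = c + d -> b = d -> a *: x + b *: y = c *: x + d *: (x + y).
Proof. by move=> -> ->; rewrite scalerDr scalerDl addrA. Qed.

Lemma scale_sum_right (R : pzRingType) (U : lmodType R) (a b c d : R) (x y : U) :
  a = d -> b = c + d -> a *: x + b *: y = c *: y + d *: (x + y).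
Proof. by move=> -> ->; rewrite scalerDr scalerDl addrCA. Qed.

(** * Case (e): the symplectic vector *)

Section FourE.

Variables (p : nat).
Hypotheses (p_pr : prime p) (p_gt4 : (4 < p)%N).
Let p_gt2 : (2 < p)%N := ltnW (ltnW p_gt4).
Local Notation F := 'F_p.
Local Notation V := 'rV['F_p]_4.
Local Notation W := (alt p 4).
Let o0 : 'I_4 := @Ordinal 4 0 isT.
Let o1 : 'I_4 := @Ordinal 4 1 isT.
Let o2 : 'I_4 := @Ordinal 4 2 isT.
Let o3 : 'I_4 := @Ordinal 4 3 isT.
Local Notation e_ i := (delta_mx 0 i : V).
Local Notation we := (we p).

Let two0 : (2 : F) != 0 := two_neq0 p_pr p_gt2.
Let n10 : (1 : F) != 0 := oner_neq0 _.
Let four1 : (2 : F) *+ 2 != 1 := four_neq1 p_pr p_gt4.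

(** Sending e_0 to e_0 + e_3 alone adds e_3 wedge e_1 to [we]; sending e_2 to e_2 + e_1 at the same
    time cancels it. This map links the hyperbolic pairs {0, 1} and {2, 3}, which the single
    transvections in [we_transv] keep apart. *)
Definition double_transv : 'M[F]_4 := 1%:M + (delta_mx o0 o3 + delta_mx o2 o1).

Lemma double_transv_row i :
  e_ i *m double_transv = e_ i + ((i == o0)%:R *: e_ o3 + (i == o2)%:R *: e_ o1).
Proof. by rewrite !mulmxDr mulmx1 !mul_delta_mx_cond !scaler_nat. Qed.

Lemma double_transv_admissible : admissible we double_transv.
Proof.
split.
- apply: (proj1 (@mulmx1_unit _ _ _ (1%:M - (delta_mx o0 o3 + delta_mx o2 o1)) _)).
  rewrite mulmxBr mulmx1 !mulmxDl mul1mx !mulmxDr !mul_delta_mx_cond /= !mulr0n !addr0.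
  by rewrite addrK.
- by apply: ord4_ind => //; rewrite !mxE /= ?mulr0n ?addr0.
have -> : double_transv ord0 ord0 = 1 by rewrite !mxE /= !mulr0n !addr0.
rewrite scale1r /we /wc /wd altact_wedge2 !double_transv_row /=.
rewrite !scale0r !scale1r !addr0 !add0r !wedgeDl (wedgeC (e_ o3)).
by rewrite [X in _ + X = _]addrC addrA subrK.
Qed.

Lemma we_rigid : rigid we.
Proof.
move=> g gA gD gE.
have g0 : g (e_ o0) = 1%:M.
  have [_ r23 c23] := rigid_transv_comm gE (k := o0) (@we_transv p o2 o3 isT) isT.
  have [_ r32 c32] := rigid_transv_comm gE (k := o0) (@we_transv p o3 o2 isT) isT.
  apply: (rigid_almost_diag gA gD gE (k := o0) (t := vec [:: 2; 1; 2; 1]) (a := o0) (b := o1)) => //.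
  - by apply: we_diag; rewrite ?mulr1.
  - by apply: ord4_ind; rewrite vecE.
  - by rewrite vecE.
  - apply: ord4_ind; apply: ord4_ind => // _ _; rewrite ?r23 ?c23 ?r32 ?c32 //.
    by rewrite ord4_0E (rigid_col0 gA).
  by right; rewrite !vecE; apply: four1.
have g3 : g (e_ o3) = 1%:M.
  have hA := double_transv_admissible.
  have := gE (e_ o0) _ hA; rewrite double_transv_row /= scale1r scale0r addr0 gD g0 !mul1mx => E.
  by have [hU _ _] := hA; rewrite -(mulKmx hU (g (e_ o3))) E mulVmx.
apply: (rigid_basis gA gD); apply: ord4_ind => //.
  exact: (rigid_transv gD gE (@we_transv p o0 o1 isT) g0).
exact: (rigid_transv gD gE (@we_transv p o3 o2 isT) g3).
Qed.

Let J := altmx we.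

Lemma wedge_lin2 (x y : F) (a b c d i j : 'I_4) :
  altmx (x *: wedge (e_ a) (e_ b) + y *: wedge (e_ c) (e_ d)) i j =
  x * ((i == a)%:R * (j == b)%:R - (j == a)%:R * (i == b)%:R)
  + y * ((i == c)%:R * (j == d)%:R - (j == c)%:R * (i == d)%:R).
Proof. by rewrite altmxD; congr (_ + _); rewrite altmxZ; congr (_ * _); apply: wedge_delta. Qed.

Lemma wedge_delta2 (a b c d i j : 'I_4) :
  altmx (wedge (e_ a) (e_ b) + wedge (e_ c) (e_ d)) i j =
  (i == a)%:R * (j == b)%:R - (j == a)%:R * (i == b)%:R
  + ((i == c)%:R * (j == d)%:R - (j == c)%:R * (i == d)%:R).
Proof. by rewrite altmxD; congr (_ + _); apply: wedge_delta. Qed.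

Lemma altmx_we i j : J i j = (i == o0)%:R * (j == o1)%:R - (j == o0)%:R * (i == o1)%:R
  + ((i == o2)%:R * (j == o3)%:R - (j == o2)%:R * (i == o3)%:R).
Proof. exact: wedge_delta2. Qed.

Lemma altmx_we_sq : J *m J = - 1%:M.
Proof.
apply/matrixP => i j; rewrite mxE !big_ord_recl big_ord0 !altmx_we !mxE.
move: i j; apply: ord4_ind; apply: ord4_ind; rewrite /= ?mulr0n ?mulr1n; ring.
Qed.

(* The symplectic form dual to we, normalised by we_form (e_i wedge e_j) = J i j;
   its kernel is the invariant complement of we. *)
Definition we_form (w : W) : F := - 2^-1 * \tr (altmx w *m J).

Lemma we_form_is_scalar : scalar we_form.
Proof.
move=> a w t; rewrite /we_form [altmx _]linearP /= mulmxDl -scalemxAl linearD linearZ /=.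
by ring.
Qed.
HB.instance Definition _ := GRing.isLinear.Build F W F _ we_form we_form_is_scalar.

Lemma we_form_delta i j : we_form (wedge (e_ i) (e_ j)) = J i j.
Proof.
have tr_delta k l : \tr (delta_mx k l *m J) = J l k.
  rewrite /mxtrace (bigD1 k) //= big1 ?addr0 => [|k' ne].
    rewrite mxE (bigD1 l) //= big1 ?addr0 => [|l' ne].
      by rewrite mxE !eqxx mul1r.
    by rewrite mxE (negPf ne) andbF mul0r.
  by rewrite mxE big1 // => l' _; rewrite mxE (negPf ne) mul0r.
rewrite /we_form altmx_wedge !trmx_delta !mul_delta_mx mulmxBl linearB /= !tr_delta.
by rewrite [J j i]altmxN -opprD mulrNN -mulr2n -[altmx we i j *+ 2]mulr_natl (mulKf two0).
Qed.

Lemma twist_delta a b i j : twist we_form we a b (wedge (e_ i) (e_ j)) =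
  a *: wedge (e_ i) (e_ j) + (b * J i j) *: we.
Proof. by rewrite -we_form_delta. Qed.

Lemma we_form_delta2 i j k l :
  we_form (wedge (e_ i) (e_ j) + wedge (e_ k) (e_ l)) = J i j + J k l.
Proof. by rewrite linearD /=; congr (_ + _); apply: we_form_delta. Qed.

Lemma we_form_we : we_form we = 2%:R.
Proof.
by rewrite /we /wc /wd we_form_delta2 2!altmx_we /= !mulr0n !mulr1n; ring.
Qed.

(** As J^2 = -1, the transpose of a similitude of J is again one, with the same multiplier;
    cyclicity of the trace does the rest. *)
Lemma we_form_act h w : admissible we h -> we_form (altact h w) = h ord0 ord0 * we_form w.
Proof.
case=> hU _ /(congr1 (@altmx _ _)); rewrite altmx_act linearZ /= -/J => hJ.
set a := h _ _ in hJ *.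
have E : h *m J *m h^T = a *: J.
  have E0 : J *m (h^T *m J *m h) = (- a)%:M.
    by rewrite hJ -scalemxAr altmx_we_sq scalerN scalemx1 raddfN.
  have E1 : J *m h^T *m J = - a *: invmx h.
    rewrite -[LHS](mulmxK hU) -(mul_scalar_mx (- a)) -E0; congr (_ *m _).
    by rewrite !mulmxA.
  have : h *m J *m h^T *m J = - a%:M.
    by rewrite -[h *m J *m _]mulmxA -[LHS]mulmxA E1 -scalemxAr mulmxV // scaleNr scalemx1.
  move/(congr1 (mulmx^~ J)); rewrite -mulmxA altmx_we_sq mulmxN mulmx1 mulNmx mul_scalar_mx.
  exact: oppr_inj.
rewrite /we_form altmx_act -/J -!mulmxA mxtrace_mulC -!mulmxA [h *m _]mulmxA E.
by rewrite -scalemxAr linearZ /= mulrCA.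
Qed.

Lemma altact_lin2 h (x y : F) (a b c d : V) :
  altact h (x *: wedge a b + y *: wedge c d) =
  x *: wedge (a *m h) (b *m h) + y *: wedge (c *m h) (d *m h).
Proof. by rewrite altactD; congr (_ + _); rewrite altactZ; congr (_ *: _); apply: altact_wedge. Qed.

Lemma altmx_opp (w : W) k l : altmx (- w) k l = - altmx w k l.
Proof. by rewrite linearN mxE. Qed.

Lemma wedge_lin2_entry (x y : F) (a b c d : V) i j :
  altmx (x *: wedge a b + y *: wedge c d) i j =
  x * (a 0 i * b 0 j - a 0 j * b 0 i) + y * (c 0 i * d 0 j - c 0 j * d 0 i).
Proof. by rewrite altmxD; congr (_ + _); rewrite altmxZ; congr (_ * _); apply: wedgeE. Qed.

Section ClassifyE.

Variable D : V -> V -> W.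
Hypotheses (Dlin : biadditive D) (Deq : equivariant we D).
Let Dl := proj1 Dlin.
Let Dr := proj2 Dlin.

Lemma pow2_neq i j : (i <= 2)%N -> (j <= 2)%N -> i != j -> (2 : F) ^+ i != 2 ^+ j.
Proof.
have two1 : (2 : F) != 1 by rewrite -subr_eq0 (_ : 2 - 1 = 1) ?oner_eq0 //; ring.
have e2 : (2 : F) ^+ 2 = 2 *+ 2 by rewrite expr2 mulr_natr.
case: i => [|[|[|i]]] //; case: j => [|[|[|j]]] // _ _ _; rewrite ?expr0 ?expr1 ?e2 //.
- by rewrite eq_sym.
- by rewrite eq_sym.
- by rewrite mulr2n -subr_eq0 opprD addrA subrr sub0r oppr_eq0.
by rewrite mulr2n -subr_eq0 addrK.
Qed.

(* The diagonal maps 2^a with a = (1,0,1,0), (1,0,0,1) are admissible, and 1, 2, 4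
   are distinct modulo p. *)
Definition weight_check (i j k l : nat) : bool :=
  has (fun a : seq nat => nth 0 a i + nth 0 a j != nth 0 a k + nth 0 a l)%N
    [:: [:: 1; 0; 1; 0]%N; [:: 1; 0; 0; 1]%N].

Lemma D_weight (i j k l : 'I_4) : weight_check i j k l -> altmx (D (e_ i) (e_ j)) k l = 0.
Proof.
rewrite /weight_check => /hasP[a]; rewrite !inE => aE ne.
pose t : V := vec [seq (2 : F) ^+ x | x <- a].
have tE (x : 'I_4) : t 0 x = 2 ^+ nth 0%N a x.
  by rewrite vecE (nth_map 0%N) //; case/orP: aE => /eqP->; rewrite /= ltn_ord.
have aP : a = [:: 1; 0; 1; 0]%N \/ a = [:: 1; 0; 0; 1]%N by case/orP: aE => /eqP->; [left | right].
have hA : admissible we (diag_mx t).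
  rewrite /t; case: aP => ->; rewrite /= expr0 expr1; apply: we_diag => //; by rewrite ?mulr1 ?mul1r.
have bound (x y : 'I_4) : (nth 0 a x + nth 0 a y <= 2)%N.
  by case: aP => ->; move: x y; apply: ord4_ind; apply: ord4_ind.
by apply: (D_diag Dlin Deq hA); rewrite !tE -!exprD; apply: pow2_neq.
Qed.

Lemma alt4_eq (w t : W) : altmx w o0 o1 = altmx t o0 o1 -> altmx w o0 o2 = altmx t o0 o2 ->
  altmx w o0 o3 = altmx t o0 o3 -> altmx w o1 o2 = altmx t o1 o2 ->
  altmx w o1 o3 = altmx t o1 o3 -> altmx w o2 o3 = altmx t o2 o3 -> w = t.
Proof. by move=> *; apply: alt_eq; apply: ord4_ind; apply: ord4_ind. Qed.

Lemma D_same i : D (e_ i) (e_ i) = 0.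
Proof.
have z k l : altmx (0 : W) k l = 0 by rewrite linear0 mxE.
by apply: alt4_eq; rewrite z; apply: D_weight; move: i; apply: ord4_ind.
Qed.

Local Notation mixed_pairs :=
  ([:: (o0, o2); (o2, o0); (o0, o3); (o3, o0)] ++ [:: (o1, o2); (o2, o1); (o1, o3); (o3, o1)]).

Lemma D_pair i j : (i, j) \in mixed_pairs ->
  D (e_ i) (e_ j) = coef D i j *: wedge (e_ i) (e_ j).
Proof.
rewrite mem_cat !inE => /orP[] /or4P[] /eqP[-> ->]; apply: alt4_eq; rewrite altmxZ wedge_delta /=.
all: first [by rewrite D_weight // !mulr0n !(mulr0, mul0r, subrr)
  | by rewrite !mulr0n !mulr1n !(mulr0, mulr1, subr0)
  | by rewrite !mulr0n !mulr1n !(mulr0, mulr1, sub0r) mulrN1 -altmxN].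
Qed.

(** Admissibility gives e_0 wedge e_1 and e_2 wedge e_3 the same weight under every diagonal map, so
    [separated] fails here and both coefficients remain. This is where the extra degree of freedom
    enters. *)
Lemma D_quad i j : (i, j) \in [:: (o0, o1); (o2, o3)] ->
  D (e_ i) (e_ j) = altmx (D (e_ i) (e_ j)) o0 o1 *: wedge (e_ o0) (e_ o1)
    + altmx (D (e_ i) (e_ j)) o2 o3 *: wedge (e_ o2) (e_ o3).
Proof.
rewrite !inE => /orP[] /eqP[-> ->]; apply: alt4_eq; rewrite [RHS]wedge_lin2 /=.
all: first [by rewrite D_weight // !mulr0n !mulr1n !(mulr0, mul0r, subrr, addr0)
  | by rewrite !mulr0n !mulr1n !(mulr0, mulr1, subr0, addr0, add0r)].
Qed.

Let coef_row r s k : r != s -> k != r -> k != s -> admissible we (transv p r s) ->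
  (r, k) \in mixed_pairs ->
  (s, k) \in mixed_pairs ->
  coef D r k = coef D s k.
Proof. by move=> rs kr ks hA /D_pair Dr' /D_pair Ds; apply: (D_transv_row Dlin Deq hA rs kr ks Dr' Ds). Qed.

Let coef_col r s k : r != s -> k != r -> k != s -> admissible we (transv p r s) ->
  (k, r) \in mixed_pairs ->
  (k, s) \in mixed_pairs ->
  coef D k r = coef D k s.
Proof. by move=> rs kr ks hA /D_pair Dr' /D_pair Ds; apply: (D_transv_col Dlin Deq hA rs kr ks Dr' Ds). Qed.

Let t01 := @we_transv p o0 o1 isT.
Let t23 := @we_transv p o2 o3 isT.

Let D_double i j := Deq (e_ i) (e_ j) double_transv_admissible.

(** The polarisation argument of [D_transv_sym], carried out with the double transvection at e_0,
    since it compares indices from different hyperbolic pairs. *)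
Lemma coef_03_30 : coef D o0 o3 = coef D o3 o0.
Proof.
have := D_double o0 o0; rewrite D_same linear0 !double_transv_row /= scale1r scale0r addr0.
rewrite Dl !Dr !D_same add0r addr0 => /esym/eqP; rewrite addr_eq0 => /eqP E.
by rewrite /coef E linearN /= mxE -altmxN.
Qed.

Lemma D_pair_const i j : (i, j) \in mixed_pairs ->
  D (e_ i) (e_ j) = coef D o0 o2 *: wedge (e_ i) (e_ j).
Proof.
move=> ij; rewrite (D_pair ij); congr (_ *: _).
have r1 : coef D o2 o0 = coef D o3 o0 by apply: coef_row t23 _ _.
have r2 : coef D o0 o2 = coef D o0 o3 by apply: coef_col t23 _ _.
have r3 : coef D o0 o2 = coef D o1 o2 by apply: coef_row t01 _ _.
have r4 : coef D o2 o0 = coef D o2 o1 by apply: coef_col t01 _ _.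
have r5 : coef D o0 o3 = coef D o1 o3 by apply: coef_row t01 _ _.
have r6 : coef D o3 o0 = coef D o3 o1 by apply: coef_col t01 _ _.
have r7 := coef_03_30.
by move: ij; rewrite mem_cat !inE => /orP[] /or4P[] /eqP[-> ->]; congruence.
Qed.

Let a01 := altmx (D (e_ o0) (e_ o1)) o0 o1.
Let b01 := altmx (D (e_ o0) (e_ o1)) o2 o3.
Let a23 := altmx (D (e_ o2) (e_ o3)) o0 o1.
Let b23 := altmx (D (e_ o2) (e_ o3)) o2 o3.
Let c := coef D o0 o2.

Lemma D32 : D (e_ o3) (e_ o2) = - D (e_ o2) (e_ o3).
Proof. exact: (D_transv_sym Dlin Deq t23 (D_same _) (D_same _)). Qed.

Lemma D10 : D (e_ o1) (e_ o0) = - D (e_ o0) (e_ o1).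
Proof. exact: (D_transv_sym Dlin Deq t01 (D_same _) (D_same _)). Qed.

Lemma D_double_02 k l : c * altmx (wedge (e_ o0 + e_ o3) (e_ o2 + e_ o1)) k l =
  altmx (D (e_ o0) (e_ o2)) k l + altmx (D (e_ o0) (e_ o1)) k l
  + (- altmx (D (e_ o2) (e_ o3)) k l + altmx (D (e_ o3) (e_ o1)) k l).
Proof.
have := D_double o0 o2; rewrite {1}(D_pair_const (i := o0) (j := o2)) //.
rewrite altactZ altact_wedge !double_transv_row /= !scale1r !scale0r addr0 add0r -/c.
move=> E; rewrite -[LHS]altmxZ E.
rewrite Dl !Dr D32 altmxD; congr (_ + _); first by rewrite altmxD.
by rewrite altmxD; congr (_ + _); apply: altmx_opp.
Qed.

(** The double transvection is applied to D(e_0, e_2), read at the entries (0, 1) and (2, 3), and to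
    D(e_0, e_1), read at (1, 3). Of the five unknowns, [c] and [a01] remain free. *)
Lemma D_relations : [/\ c = a01 - a23, - c = b01 - b23 & - c = b01 - a01].
Proof.
have ee (i j k : 'I_4) : (e_ i + e_ j) 0 k = (k == i)%:R + (k == j)%:R by rewrite !mxE.
have e1 (i k : 'I_4) : (e_ i) 0 k = (k == i)%:R by rewrite mxE.
split.
- have := D_double_02 o0 o1; rewrite wedgeE !ee /=.
  rewrite (D_weight (i := o0) (j := o2)) // (D_weight (i := o3) (j := o1)) //.
  rewrite !mulr0n !mulr1n !(addr0, add0r, mulr0, mulr1, subr0) //.
- have := D_double_02 o2 o3; rewrite wedgeE !ee /=.
  rewrite (D_weight (i := o0) (j := o2)) // (D_weight (i := o3) (j := o1)) //.
  rewrite !mulr0n !mulr1n !(addr0, add0r, mulr0, mulr1, sub0r) mulrN1 //.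
have := D_double o0 o1; rewrite [X in altact _ X](D_quad (i := o0) (j := o1)) // -/a01 -/b01.
rewrite altact_lin2 !double_transv_row /= !scale1r !scale0r !addr0 !add0r Dl.
move/(congr1 (fun w => altmx w o1 o3)); rewrite [RHS]altmxD.
rewrite [LHS]wedge_lin2_entry !ee !e1 /=.
rewrite (D_weight (i := o0) (j := o1)) // (D_pair_const (i := o3) (j := o1)) // -/c.
rewrite altmxZ wedge_delta /= !mulr0n !mulr1n.
rewrite !(addr0, add0r, mulr0, mulr1, sub0r, subr0) !mulrN1 => E.
by rewrite -E addrC.
Qed.

Lemma D_is_twist u v : D u v = twist we_form we c (a01 - c) (wedge u v).
Proof.
have [r1 r2 r3] := D_relations.
apply: (biadditive_ext (D' := fun u v => twist we_form we c (a01 - c) (wedge u v)) Dlin).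
  exact: (biadditive_wedge (twist we_form we c (a01 - c))).
have same i : D (e_ i) (e_ i) = twist we_form we c (a01 - c) (wedge (e_ i) (e_ i)).
  by rewrite D_same wedgexx linear0.
have pair i j : (i, j) \in mixed_pairs ->
    D (e_ i) (e_ j) = twist we_form we c (a01 - c) (wedge (e_ i) (e_ j)).
  move=> ij; rewrite (D_pair_const ij) twist_delta (_ : J i j = 0) ?mulr0 ?scale0r ?addr0 //.
  move: ij; rewrite altmx_we mem_cat !inE => /orP[] /or4P[] /eqP[-> ->] /=;
    by rewrite !mulr0n !(mulr0, mul0r, subrr, addr0).
have twE i j : J i j = 1 -> twist we_form we c (a01 - c) (wedge (e_ i) (e_ j)) =
    c *: wedge (e_ i) (e_ j) + (a01 - c) *: we.
  by move=> Jij; rewrite twist_delta Jij mulr1.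
have q01 : D (e_ o0) (e_ o1) = twist we_form we c (a01 - c) (wedge (e_ o0) (e_ o1)).
  rewrite twE; last by rewrite altmx_we /= !mulr0n !mulr1n; ring.
  have -> : D (e_ o0) (e_ o1) = a01 *: wedge (e_ o0) (e_ o1) + b01 *: wedge (e_ o2) (e_ o3) :=
    D_quad (i := o0) (j := o1) isT.
  by apply: scale_sum_left; [rewrite addrC subrK | rewrite r3 addrC subrK].
have q23 : D (e_ o2) (e_ o3) = twist we_form we c (a01 - c) (wedge (e_ o2) (e_ o3)).
  rewrite twE; last by rewrite altmx_we /= !mulr0n !mulr1n; ring.
  have -> : D (e_ o2) (e_ o3) = a23 *: wedge (e_ o0) (e_ o1) + b23 *: wedge (e_ o2) (e_ o3) :=
    D_quad (i := o2) (j := o3) isT.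
  apply: scale_sum_right; first by rewrite r1 opprB addrC subrK.
  by rewrite addrC subrK; apply: oppr_inj; apply: (addrI b01); rewrite -r2 -r3.
have q10 : D (e_ o1) (e_ o0) = twist we_form we c (a01 - c) (wedge (e_ o1) (e_ o0)).
  by rewrite D10 q01 (wedgeC (e_ o1)) twistN.
have q32 : D (e_ o3) (e_ o2) = twist we_form we c (a01 - c) (wedge (e_ o3) (e_ o2)).
  by rewrite D32 q23 (wedgeC (e_ o3)) twistN.
apply: ord4_ind; apply: ord4_ind;
  [ exact: (same o0) | exact: q01 | exact: (pair o0 o2 isT) | exact: (pair o0 o3 isT)
  | exact: q10 | exact: (same o1) | exact: (pair o1 o2 isT) | exact: (pair o1 o3 isT)
  | exact: (pair o2 o0 isT) | exact: (pair o2 o1 isT) | exact: (same o2) | exact: q23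
  | exact: (pair o3 o0 isT) | exact: (pair o3 o1 isT) | exact: q32 | exact: (same o3) ].
Qed.

End ClassifyE.

Lemma T_we : T (model we) \isog [set: {unit 'F_p} * {unit 'F_p}].
Proof.
pose U := ({unit 'F_p} * {unit 'F_p})%type.
pose d (u : U) : F := FinRing.uval u.1.
pose lam (u : U) : F := FinRing.uval u.2.
(* The second parameter is chosen so that the eigenvalue on [we] is 1, while the invariant
   complement is scaled by [lam u]. *)
pose L (u : U) : {linear W -> W} := twist we_form we (lam u) (2^-1 * (1 - lam u)).
have ee := we_form_we.
have Lval (a : F) : a + 2%:R * (2^-1 * (1 - a)) = 1 by rewrite mulrA mulfV // mul1r addrC subrK.
have we_02 : altmx we o0 o2 = 0 by rewrite altmx_we /= !mulr0n; ring.
have we_01 : altmx we o0 o1 = 1 by rewrite altmx_we /= !mulr0n !mulr1n; ring.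
have we_neq0 : we != 0.
  apply/eqP => we0; have := we_01; rewrite we0 linear0 mxE => /esym/eqP.
  by rewrite oner_eq0.
have w02 : altmx (wedge (e_ o0) (e_ o2)) o0 o2 = 1.
  by rewrite wedge_delta /= !mulr0n !mulr1n !mulr1 mulr0 subr0.
have entry (a b : F) w : altmx (twist we_form we a b w) o0 o2 = a * altmx w o0 o2.
  by rewrite /twist altmxD altmxZ altmxZ we_02 mulr0 addr0.
apply: (@T_model p 3 p_pr p_gt2 we we_neq0 U d L).
- by move=> u v.
- by move=> u; rewrite -unitfE; apply: (valP u.1).
- move=> u v w; rewrite /L [RHS]/= (twistM ee) Lval mulr1.
  have -> : lam (u * v)%g = lam v * lam u by rewrite mulrC.
  by congr (twist _ _ _ _ w); ring.
- move=> w; rewrite /L /= /lam /= subrr mulr0; apply: twist10.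
- by move=> u; rewrite /L /= (twist_e ee) Lval scale1r.
- move=> u h w hA; have [_ _ hwe] := hA; apply: (twist_comm (f := altact h) _ _ hwe).
  exact: we_form_act.
- move=> u du Lu; case: u du Lu => u1 u2 /= du Lu.
  have l1 : lam (u1, u2) = 1.
    by have := Lu (wedge (e_ o0) (e_ o2)) => /(congr1 (fun w => altmx w o0 o2)); rewrite entry w02 mulr1.
  by congr (_, _); apply: val_inj.
- exact: we_rigid.
move=> D Dlin Deq nondeg; have := D_is_twist Dlin Deq.
set x := coef D o0 o2; set y := _ - x => DE.
(* These are the parameters of N = 1 - 2D. Its eigenvalues a and nu are nonzero because N is onto,
   and dividing by nu gives d = 1/nu and lam = a/nu. *)
pose a := 1 - 2%:R * x; pose b := - 2%:R * y; pose nu := a + 2%:R * b.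
have N_surj := nondeg (twist we_form we a b)
  (fun u v => etrans (DE u v) (esym (half_sub_twist _ _ two0 _ _ _))).
have a_neq0 : a != 0.
  apply/eqP => a0; have [w /(congr1 (fun t => altmx t o0 o2))] := N_surj (wedge (e_ o0) (e_ o2)).
  by rewrite /= entry w02 a0 mul0r => /esym/eqP; rewrite oner_eq0.
have nu_neq0 : nu != 0.
  apply/eqP => nu0; have [w /(congr1 we_form)] := N_surj we.
  by rewrite /= (om_twist ee) -/nu nu0 mul0r ee => /esym/eqP; rewrite (negPf two0).
have nuU : nu^-1 \is a GRing.unit by rewrite unitrV unitfE.
have aU : a / nu \is a GRing.unit by rewrite unitfE mulf_neq0 // invr_eq0.
pose u : U := (FinRing.unit F nuU, FinRing.unit F aU).
have du : (d u)^-1 = nu by rewrite /d /= invrK.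
have NE w : twist we_form we a b w = nu *: L u w.
  exact: (twist_normalize _ _ two0).
by exists u => v v'; rewrite DE -(half_sub_twist we_form we two0) NE /witness_form /defect du.
Qed.

End FourE.

Local Close Scope ring_scope.

(** * Orders and the five presentations *)

Lemma card_model p m (w0 : alt p m.+1) : prime p ->
  #|[set: model w0]| = (p ^ (m.+1 + #|{: upair m.+1}|))%N.
Proof.
move=> p_pr; rewrite cardsT -[LHS]/(#|{: 'rV['F_p]_m.+1 * alt p m.+1}|).
by rewrite card_prod card_mx mul1n card_ffun !card_Fp // expnD.
Qed.

Lemma card_upair n : #|{: upair n}| = (\sum_(i < n) \sum_(j < n) (i < j))%N.
Proof.
rewrite card_sig -sum1_card big_mkcond pair_bigA /=.
by apply: eq_bigr => -[i j] _ /=; rewrite unfold_in /=; case: ltnP.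
Qed.

Lemma card_upair3 : #|{: upair 3}| = 3.
Proof. by rewrite card_upair !big_ord_recl !big_ord0. Qed.

Lemma card_upair4 : #|{: upair 4}| = 6.
Proof. by rewrite card_upair !big_ord_recl !big_ord0. Qed.

Lemma presented_by_ext n (R R' : forall H : groupType, ('I_n -> H) -> Prop) G :
  (forall (H : groupType) (y : 'I_n -> H), R H y <-> R' H y) ->
  presented_by R G -> presented_by R' G.
Proof.
move=> RR' [x [/RR' xR xU]]; exists x; split=> // H y /RR'; apply: xU.
Qed.

Lemma presented_model p m N (w0 : alt p m.+1) (U : finGroupType)
    (R : forall H : groupType, ('I_m.+1 -> H) -> Prop) :
    prime p -> (2 < p)%N -> (m.+1 + #|{: upair m.+1}|)%N = N ->
    (forall (H : groupType) (y : 'I_m.+1 -> H), R H y <-> rels_of w0 y) ->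
    T (model w0) \isog [set: U] ->
  (exists G : finGroupType, presented_by R G) /\
  (forall G : finGroupType, presented_by R G ->
     #|[set: G]| = (p ^ N)%N /\ T G \isog [set: U]).
Proof.
move=> p_pr p_gt2 <- RE TU; have MR := model_presented p_pr p_gt2 w0.
split=> [|G GR].
  by exists (model w0); apply: presented_by_ext MR => H y; split=> /RE.
have [f [fM [g fK gK]]] := presented_iso (presented_by_ext RE GR) MR.
split; last exact: isog_trans (T_transfer fM fK gK) TU.
rewrite -(card_model w0 p_pr) !cardsT.
by apply: bij_eq_card; exists g.
Qed.

Section Relations.

Variables (p : nat) (H : groupType).
Hypotheses (p_pr : prime p) (p_gt2 : (2 < p)%N).

Let o0 : 'I_3 := @Ordinal 3 0 isT.
Let o1 : 'I_3 := @Ordinal 3 1 isT.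
Let o2 : 'I_3 := @Ordinal 3 2 isT.

Lemma inord3 : [/\ inord 0 = o0, inord 1 = o1 & inord 2 = o2].
Proof. by split; apply: val_inj; rewrite /= inordK. Qed.

Lemma class2_rels3 (y : 'I_3 -> H) : (forall i j k, [~ [~ y i, y j], y k] = 1) ->
  y o1 ^+ p = 1 -> y o2 ^+ p = 1 -> class2_rels p y.
Proof. by move=> yc y1 y2; split=> //; apply: ord3_ind. Qed.

Lemma rels_aE (y : 'I_3 -> H) : rels_a p y <-> rels_of (wa p) y.
Proof.
rewrite /rels_a; have [-> -> ->] := inord3; rewrite (o0E : o0 = ord0).
split=> [[yc y1 y2 y0]|[yc yp y0]].
  have ycl := class2_rels3 yc y1 y2; case: (ycl) => _ yp; split=> //.
  by rewrite (wprod_wedge p_pr ycl) // y0 -o0E.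
have ycl : class2_rels p y by [].
split; [exact: yc | exact: yp | exact: yp | ].
by rewrite y0 (wprod_wedge p_pr ycl) // -o0E.
Qed.

Lemma rels_bE (y : 'I_3 -> H) : rels_b p y <-> rels_of (wb p) y.
Proof.
rewrite /rels_b; have [-> -> ->] := inord3; rewrite (o0E : o0 = ord0).
split=> [[yc y1 y2 y0]|[yc yp y0]].
  have ycl := class2_rels3 yc y1 y2; case: (ycl) => _ yp; split=> //.
  by rewrite (wprod_wedge p_pr ycl).
have ycl : class2_rels p y by [].
split; [exact: yc | exact: yp | exact: yp | ].
by rewrite y0 (wprod_wedge p_pr ycl).
Qed.

Let i0 : 'I_4 := @Ordinal 4 0 isT.
Let i1 : 'I_4 := @Ordinal 4 1 isT.
Let i2 : 'I_4 := @Ordinal 4 2 isT.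
Let i3 : 'I_4 := @Ordinal 4 3 isT.

Lemma inord4 : [/\ inord 0 = i0, inord 1 = i1, inord 2 = i2 & inord 3 = i3].
Proof. by split; apply: val_inj; rewrite /= inordK. Qed.

Lemma class2_rels4 (y : 'I_4 -> H) : (forall i j k, [~ [~ y i, y j], y k] = 1) ->
  y i1 ^+ p = 1 -> y i2 ^+ p = 1 -> y i3 ^+ p = 1 -> class2_rels p y.
Proof. by move=> yc y1 y2 y3; split=> //; apply: ord4_ind. Qed.

Lemma rels_cE (y : 'I_4 -> H) : rels_c p y <-> rels_of (wc p) y.
Proof.
rewrite /rels_c; have [-> -> -> ->] := inord4; rewrite (ord4_0E : i0 = ord0).
split=> [[yc y1 y2 y3 y0]|[yc yp y0]].
  have ycl := class2_rels4 yc y1 y2 y3; case: (ycl) => _ yp; split=> //.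
  by rewrite (wprod_wedge p_pr ycl) // y0 -ord4_0E.
have ycl : class2_rels p y by [].
split; [exact: yc | exact: yp | exact: yp | exact: yp | ].
by rewrite y0 (wprod_wedge p_pr ycl) // -ord4_0E.
Qed.

Lemma rels_dE (y : 'I_4 -> H) : rels_d p y <-> rels_of (wd p) y.
Proof.
rewrite /rels_d; have [-> -> -> ->] := inord4; rewrite (ord4_0E : i0 = ord0).
split=> [[yc y1 y2 y3 y0]|[yc yp y0]].
  have ycl := class2_rels4 yc y1 y2 y3; case: (ycl) => _ yp; split=> //.
  by rewrite (wprod_wedge p_pr ycl).
have ycl : class2_rels p y by [].
split; [exact: yc | exact: yp | exact: yp | exact: yp | ].
by rewrite y0 (wprod_wedge p_pr ycl).
Qed.

Lemma rels_eE (y : 'I_4 -> H) : rels_e p y <-> rels_of (we p) y.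
Proof.
rewrite /rels_e; have [-> -> -> ->] := inord4; rewrite (ord4_0E : i0 = ord0).
split=> [[yc y1 y2 y3 y0]|[yc yp y0]].
  have ycl := class2_rels4 yc y1 y2 y3; case: (ycl) => _ yp; split=> //.
  rewrite (wprodD p_pr ycl) y0 -ord4_0E.
  by congr (_ * _); apply/esym/(wprod_wedge p_pr ycl).
have ycl : class2_rels p y by [].
split; [exact: yc | exact: yp | exact: yp | exact: yp | ].
by rewrite y0 (wprodD p_pr ycl) -ord4_0E; congr (_ * _); apply: (wprod_wedge p_pr ycl).
Qed.

End Relations.

Lemma wedge_delta_neq0 p m (i j : 'I_m.+1) : (i < j)%N ->
  (wedge (delta_mx 0 i : 'rV['F_p]_m.+1) (delta_mx 0 j) != 0)%R.
Proof.
move=> ij; apply/eqP => /(congr1 (fun w => altmx w i j)).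
rewrite wedge_delta linear0 mxE !eqxx [j == i]eq_sym (ltn_eqF ij : (i == j) = false).
by rewrite mulr0 subr0 mulr1 => /eqP; rewrite oner_eq0.
Qed.

Theorem theorem1p1 :
  [/\ (forall p : nat, prime p -> 5 <= p ->
      (exists G : finGroupType, presented_by (rels_a p) G) /\
      (forall G : finGroupType, presented_by (rels_a p) G ->
         #|[set: G]| = (p ^ 6)%N /\ T G \isog [set: {unit 'F_p}])),
      (forall p : nat, prime p -> 3 <= p ->
      (exists G : finGroupType, presented_by (rels_b p) G) /\
      (forall G : finGroupType, presented_by (rels_b p) G ->
         #|[set: G]| = (p ^ 6)%N /\ T G \isog [set: {unit 'F_p}])),
      (forall p : nat, prime p -> 5 <= p ->
      (exists G : finGroupType, presented_by (rels_c p) G) /\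
      (forall G : finGroupType, presented_by (rels_c p) G ->
         #|[set: G]| = (p ^ 10)%N /\ T G \isog [set: {unit 'F_p}])),
      (forall p : nat, prime p -> 3 <= p ->
      (exists G : finGroupType, presented_by (rels_d p) G) /\
      (forall G : finGroupType, presented_by (rels_d p) G ->
         #|[set: G]| = (p ^ 10)%N /\ T G \isog [set: {unit 'F_p}]))
    & (forall p : nat, prime p -> 5 <= p ->
      (exists G : finGroupType, presented_by (rels_e p) G) /\
      (forall G : finGroupType, presented_by (rels_e p) G ->
         #|[set: G]| = (p ^ 10)%N /\ T G \isog [set: {unit 'F_p} * {unit 'F_p}]))].
Proof.
have c3 : (3 + #|{: upair 3}|)%N = 6 by rewrite card_upair3.
have c4 : (4 + #|{: upair 4}|)%N = 10 by rewrite card_upair4.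
split=> p p_pr p_gt.
- have p_gt2 : 2 < p := ltnW (ltnW p_gt).
  apply: (presented_model p_pr p_gt2 c3 (fun H y => @rels_aE p H p_pr y)).
  exact: (T_scalar p_pr p_gt2 (wedge_delta_neq0 _ _) (wa_rigid p_pr p_gt2 p_gt) (wa_scalar p_pr p_gt2)).
- apply: (presented_model p_pr p_gt c3 (fun H y => @rels_bE p H p_pr y)).
  exact: (T_scalar p_pr p_gt (wedge_delta_neq0 _ _) (wb_rigid p_pr p_gt) (wb_scalar p_pr p_gt)).
- have p_gt2 : 2 < p := ltnW (ltnW p_gt).
  apply: (presented_model p_pr p_gt2 c4 (fun H y => @rels_cE p H p_pr y)).
  exact: (T_scalar p_pr p_gt2 (wedge_delta_neq0 _ _) (wc_rigid p_pr p_gt2 p_gt) (wc_scalar p_pr p_gt2)).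
- apply: (presented_model p_pr p_gt c4 (fun H y => @rels_dE p H p_pr y)).
  exact: (T_scalar p_pr p_gt (wedge_delta_neq0 _ _) (wd_rigid p_pr p_gt) (wd_scalar p_pr p_gt)).
have p_gt2 : 2 < p := ltnW (ltnW p_gt).
apply: (presented_model p_pr p_gt2 c4 (fun H y => @rels_eE p H p_pr y)).
exact: (T_we p_pr p_gt).
Qed.
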